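(* Let $\beta=(\beta_n)_{n\ge0}$ be a sequence of positive numbers with $\liminf_{n\to\infty}\beta_n^{1/n}\ge1$. The following assertions are equivalent: 1) all symbols $\varphi$ such that $\varphi(0)=0$ induce bounded composition operators $C_\varphi$ on $H^2(\beta)$ and $$\sup_{\varphi(0)=0}\|C_\varphi\|<\infty,$$ the supremum being over all symbols $\varphi$ with $\varphi(0)=0$; 2) $\beta$ is an essentially decreasing sequence.
   Context: $\mathbb{D}$ is the open unit disk of $\mathbb{C}$. For a sequence $\beta=(\beta_n)_{n\ge0}$ of positive numbers with $\liminf_{n\to\infty}\beta_n^{1/n}\ge1$, $H^2(\beta)$ is the Hilbert space of analytic functions $f(z)=\sum_{n\ge0}a_nz^n$ on $\mathbb{D}$ such that $\|f\|^2=\sum_{n\ge0}|a_n|^2\beta_n<\infty$. A symbol is a non-constant analytic map $\varphi:\mathbb{D}\to\mathbb{D}$, and $C_\varphi(f)=f\circ\varphi$; it is bounded on $H^2(\beta)$ if it maps $H^2(\beta)$ boundedly into itself, and $\|C_\varphi\|$ is its operator norm on $H^2(\beta)$. The sequence $\beta$ is essentially decreasing if for some constant $C\ge1$ one has $\beta_m\le C\beta_n$ for all $m\ge n\ge0$. *)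

(* Defs.v *)
From Stdlib Require Export Reals.
From Coquelicot Require Export Coquelicot.

Open Scope R_scope.

Definition unit_disk (z : C) : Prop := Cmod z < 1.

Definition power_series_at (f : C -> C) (z0 : C) (r : R) (a : nat -> C) : Prop :=
  forall h : C, Cmod h < r ->
    @is_pseries C_AbsRing C_NormedModule a h (f (Cplus z0 h)).

(* Functions on the disk are represented by maps C -> C whose values outside
   the disk are irrelevant: r may always be taken small enough for the ball
   of radius r around z0 to stay inside the disk. *)
Definition analytic_on_disk (f : C -> C) : Prop :=
  forall z0 : C, unit_disk z0 ->
    exists (r : R) (a : nat -> C), 0 < r /\ power_series_at f z0 r a.

Definition symbol (phi : C -> C) : Prop :=
  analytic_on_disk phi /\
  (forall z : C, unit_disk z -> unit_disk (phi z)) /\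
  (exists z w : C, unit_disk z /\ unit_disk w /\ phi z <> phi w).

Definition weight (beta : nat -> R) : Prop :=
  (forall n : nat, 0 < beta n) /\
  (* The junk value of the root at n = 0 does not affect the inferior limit. *)
  Rbar_le 1 (LimInf_seq (fun n : nat => Rpower (beta n) (/ INR n))).

(* f(z) = sum_n a_n z^n on the whole disk; f is then analytic there, and a is
   uniquely determined by f. *)
Definition taylor_on_disk (f : C -> C) (a : nat -> C) : Prop :=
  forall z : C, unit_disk z -> @is_pseries C_AbsRing C_NormedModule a z (f z).

Definition H2 (beta : nat -> R) (f : C -> C) : Prop :=
  exists a : nat -> C,
    taylor_on_disk f a /\ ex_series (fun n : nat => Cmod (a n) ^ 2 * beta n).

(* The norm, as the relation "f belongs to H2 beta and has norm x". *)
Definition H2_norm (beta : nat -> R) (f : C -> C) (x : R) : Prop :=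
  exists a : nat -> C,
    taylor_on_disk f a /\
    ex_series (fun n : nat => Cmod (a n) ^ 2 * beta n) /\
    x = sqrt (Series (fun n : nat => Cmod (a n) ^ 2 * beta n)).

Definition comp_op (phi f : C -> C) : C -> C := fun z : C => f (phi z).

Definition comp_op_bounded (beta : nat -> R) (phi : C -> C) : Prop :=
  (forall f : C -> C, H2 beta f -> H2 beta (comp_op phi f)) /\
  (exists M : R, forall (f : C -> C) (x y : R),
     H2_norm beta f x -> H2_norm beta (comp_op phi f) y -> y <= M * x).

(* Meaningful when comp_op phi maps H2 beta into itself. *)
Definition comp_op_norm (beta : nat -> R) (phi : C -> C) : Rbar :=
  Lub_Rbar (fun y : R => exists (f : C -> C) (x : R),
    H2_norm beta f x /\ x <= 1 /\ H2_norm beta (comp_op phi f) y).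

Definition essentially_decreasing (beta : nat -> R) : Prop :=
  exists K : R, 1 <= K /\
    forall m n : nat, (n <= m)%nat -> beta m <= K * beta n.

(* Main.v *)
From Stdlib Require Import Arith Lra Lia Classical ClassicalEpsilon.
Require Import Defs.

(** Sufficiency. If phi(0) = 0 and f = f_0 + z g, then f o phi = f_0 + phi (g o phi), and
    multiplication by phi is a contraction of the Hardy space raising the order of
    vanishing; by induction the partial sums of |f_n|^2 dominate those of the squared
    coefficients of f o phi (Rogosinski). Abel summation against the running minimum of
    beta, which is non-increasing and comparable to beta, gives ||f o phi||^2 <= K ||f||^2.
    All coefficient bounds come from averaging over roots of unity.

    Necessity. For phi(z) = (1 - 1/n) z + (1/n) z^(j+1) the coefficient of z^(n+j) in
    phi^n is (1 - 1/n)^(n-1) >= 1/3, so testing C_phi on z^n bounds beta_(n+j) by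
    9 M^2 beta_n.

    Since analyticity means a local power series at each point, one also has to show
    that a bounded analytic map has a single power series on the whole disk; this is
    Weierstrass' argument by re-expansion at points near the circle of convergence. *)

(** * Complex series *)

(** Cauchy products, re-expansion at another centre and composition all rest on one interchange of
    summation, that of an absolutely summable triangular array, so a single lemma serves all three.
    Roots of unity replace integral means because the average over p + 1 of them is exact on
    polynomials of degree at most p: a pointwise bound by a polynomial on a circle becomes a bound
    between sums of squared coefficients, and Cauchy's estimates and the uniqueness of Taylor
    coefficients are special cases. Polynomial bounds suffice for Rogosinski's inequality, since
    phi(0) = 0 makes the coefficients of f o phi up to order K depend only on those of f up to order
    K. In the test symbols the weight 1/n offsets the n ways of picking the term z^(j+1) exactly
    once in phi^n, so that only the factor (1 - 1/n)^(n-1) is lost, uniformly in j. The exponent n =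
    0 yields constants only and carries no information, so beta_0 is related to the other weights
    through beta_1. *)

Definition csum (a : nat -> C) (n : nat) : C := @sum_n C_AbelianMonoid a n.
Definition rsum (a : nat -> R) (n : nat) : R := @sum_n R_AbelianMonoid a n.
Notation cseries := (@is_series C_AbsRing C_NormedModule).

Lemma rsum_0 (a : nat -> R) : rsum a 0 = a 0%nat.
Proof. exact (@sum_O R_AbelianMonoid a). Qed.

Lemma csum_0 (a : nat -> C) : csum a 0 = a 0%nat.
Proof. exact (@sum_O C_AbelianMonoid a). Qed.

Lemma rsum_S (a : nat -> R) (n : nat) : rsum a (S n) = rsum a n + a (S n).
Proof. exact (@sum_Sn R_AbelianMonoid a n). Qed.

Lemma csum_S (a : nat -> C) (n : nat) :
  csum a (S n) = (csum a n + a (S n))%C.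
Proof. exact (@sum_Sn C_AbelianMonoid a n). Qed.

Lemma csum_ext (a b : nat -> C) (n : nat) :
  (forall k, (k <= n)%nat -> a k = b k) -> csum a n = csum b n.
Proof. exact (sum_n_ext_loc a b n). Qed.

Lemma rsum_ext (a b : nat -> R) (n : nat) :
  (forall k, (k <= n)%nat -> a k = b k) -> rsum a n = rsum b n.
Proof. exact (sum_n_ext_loc a b n). Qed.

Lemma rsum_shift (a : nat -> R) (n : nat) :
  rsum a (S n) = a 0%nat + rsum (fun k => a (S k)) n.
Proof.
  induction n as [|n IH].
  - now rewrite rsum_S, ?rsum_0, ?csum_0.
  - rewrite rsum_S, IH, (rsum_S (fun k => a (S k))). ring.
Qed.

Lemma csum_shift (a : nat -> C) (n : nat) :
  csum a (S n) = (a 0%nat + csum (fun k => a (S k)) n)%C.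
Proof.
  induction n as [|n IH].
  - now rewrite csum_S, ?rsum_0, ?csum_0.
  - rewrite csum_S, IH, (csum_S (fun k => a (S k))). ring.
Qed.

Lemma csum_plus (a b : nat -> C) (n : nat) :
  csum (fun k => a k + b k)%C n = (csum a n + csum b n)%C.
Proof. exact (sum_n_plus a b n). Qed.

Lemma csum_scal (c : C) (a : nat -> C) (n : nat) :
  csum (fun k => c * a k)%C n = (c * csum a n)%C.
Proof. exact (@sum_n_mult_l C_Ring c a n). Qed.

Lemma rsum_scal (c : R) (a : nat -> R) (n : nat) :
  rsum (fun k => c * a k) n = c * rsum a n.
Proof. exact (@sum_n_mult_l R_Ring c a n). Qed.

Lemma csum_minus (a b : nat -> C) (n : nat) :
  csum (fun k => a k - b k)%C n = (csum a n - csum b n)%C.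
Proof.
  induction n as [|n IH].
  - now rewrite ?rsum_0, ?csum_0.
  - rewrite !csum_S, IH. ring.
Qed.

Lemma rsum_minus (a b : nat -> R) (n : nat) :
  rsum (fun k => a k - b k) n = rsum a n - rsum b n.
Proof.
  induction n as [|n IH].
  - now rewrite !rsum_0.
  - rewrite !rsum_S, IH. ring.
Qed.

Lemma csum_zero (a : nat -> C) (n : nat) :
  (forall k, (k <= n)%nat -> a k = RtoC 0) -> csum a n = RtoC 0.
Proof.
  intros H. rewrite (csum_ext _ (fun _ => RtoC 0)) by exact H.
  clear H. induction n as [|n IH].
  - apply csum_0.
  - rewrite csum_S, IH. ring.
Qed.

Lemma RtoC_rsum (a : nat -> R) (n : nat) :
  RtoC (rsum a n) = csum (fun k => RtoC (a k)) n.
Proof.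
  induction n as [|n IH].
  - now rewrite ?rsum_0, ?csum_0.
  - now rewrite rsum_S, csum_S, <- IH, RtoC_plus.
Qed.

Lemma Cmod_csum (a : nat -> C) (n : nat) :
  Cmod (csum a n) <= rsum (fun k => Cmod (a k)) n.
Proof.
  induction n as [|n IH].
  - rewrite ?rsum_0, ?csum_0; lra.
  - rewrite csum_S, rsum_S. eapply Rle_trans; [apply Cmod_triangle|]. lra.
Qed.

Lemma rsum_le_loc (a b : nat -> R) (n : nat) :
  (forall k, (k <= n)%nat -> a k <= b k) -> rsum a n <= rsum b n.
Proof.
  intros H. induction n as [|n IH].
  - rewrite ?rsum_0, ?csum_0; auto.
  - rewrite !rsum_S. assert (rsum a n <= rsum b n) by (apply IH; auto).
    specialize (H (S n) (Nat.le_refl _)). lra.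
Qed.

Lemma rsum_nonneg (a : nat -> R) (n : nat) :
  (forall k, 0 <= a k) -> 0 <= rsum a n.
Proof.
  intros H. induction n as [|n IH].
  - rewrite ?rsum_0, ?csum_0; auto.
  - rewrite rsum_S. specialize (H (S n)). lra.
Qed.

Lemma rsum_incr (a : nat -> R) (n m : nat) :
  (forall k, 0 <= a k) -> (n <= m)%nat -> rsum a n <= rsum a m.
Proof.
  intros H Hnm. induction Hnm as [|m Hnm IH]; [lra|].
  rewrite rsum_S. specialize (H (S m)). lra.
Qed.

Lemma rsum_term_le (a : nat -> R) (k n : nat) :
  (forall i, 0 <= a i) -> (k <= n)%nat -> a k <= rsum a n.
Proof.
  intros H Hk. apply Rle_trans with (rsum a k); [|now apply rsum_incr].
  destruct k as [|k].
  - rewrite ?rsum_0, ?csum_0; lra.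
  - rewrite rsum_S. pose proof (rsum_nonneg a k H). lra.
Qed.

(** Convergence in C becomes a limit of real numbers, so that squeezing and comparison of real
    sequences apply. *)
Lemma cseries_Cmod (a : nat -> C) (l : C) :
  cseries a l <-> is_lim_seq (fun n => Cmod (csum a n - l)) 0.
Proof.
  assert (E : cseries a l <-> forall eps : posreal,
    eventually (fun n => Cmod (csum a n - l) < eps)).
  { unfold is_series.
    rewrite (@filterlim_locally_ball_norm C_AbsRing nat C_NormedModule
               eventually _ (sum_n a) l).
    split; intros H eps; generalize (H eps); apply filter_imp; intros n Hn;
      exact Hn. }
  rewrite E, <- is_lim_seq_spec. unfold is_lim_seq'.
  split; intros H eps; generalize (H eps); apply filter_imp; intros n Hn;
    [rewrite Rminus_0_r, Rabs_pos_eq by apply Cmod_ge_0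
    |rewrite Rminus_0_r, Rabs_pos_eq in Hn by apply Cmod_ge_0]; exact Hn.
Qed.

Lemma pow_n_Cpow (z : C) (n : nat) : @pow_n C_Ring z n = (z ^ n)%C.
Proof. induction n as [|n IH]; simpl; [reflexivity|now rewrite IH]. Qed.

Lemma is_pseries_C (a : nat -> C) (z l : C) :
  @is_pseries C_AbsRing C_NormedModule a z l
  <-> cseries (fun k => a k * z ^ k)%C l.
Proof.
  unfold is_pseries.
  assert (E : forall n, @scal C_Ring C_ModuleSpace (pow_n z n) (a n) = (a n * z ^ n)%C)
    by (intros n; rewrite pow_n_Cpow; apply Cmult_comm).
  split; apply is_series_ext; intros n; [|symmetry]; apply E.
Qed.

Lemma cseries_unique (a : nat -> C) (l l' : C) :
  cseries a l -> cseries a l' -> l = l'.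
Proof.
  exact (@filterlim_locally_unique nat C_AbsRing C_NormedModule
           eventually _ (sum_n a) l l').
Qed.

Lemma series_nonneg_bounded (a : nat -> R) (M : R) :
  (forall k, 0 <= a k) -> (forall n, rsum a n <= M) ->
  ex_series a /\ Series a <= M.
Proof.
  intros Ha HM.
  destruct (ex_finite_lim_seq_incr (rsum a) M) as [l Hl].
  - intros n. rewrite rsum_S. specialize (Ha (S n)). lra.
  - exact HM.
  - assert (Hs : is_series a l) by exact Hl.
    split; [now exists l|].
    rewrite (is_series_unique a l Hs).
    apply (is_lim_seq_le (rsum a) (fun _ => M) l M HM Hl).
    apply is_lim_seq_const.
Qed.

Lemma rsum_le_Series (a : nat -> R) (n : nat) :
  (forall k, 0 <= a k) -> ex_series a -> rsum a n <= Series a.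
Proof.
  intros Ha [l Hl]. rewrite (is_series_unique a l Hl).
  apply (is_lim_seq_incr_compare (rsum a) l Hl).
  intros k. rewrite rsum_S. specialize (Ha (S k)). lra.
Qed.

Lemma cseries_of_abs (a : nat -> C) :
  ex_series (fun k => Cmod (a k)) -> exists l, cseries a l.
Proof.
  intros H.
  apply (@ex_series_le C_AbsRing C_CompleteNormedModule a (fun k => Cmod (a k))).
  - intros n. apply Rle_refl.
  - exact H.
Qed.

(** The partial sums of orders [n] and [m + n] differ by at most a block of the series of moduli;
    then [m] tends to infinity. *)
Lemma cseries_Cmod_tail (a : nat -> C) (l : C) (n : nat) :
  ex_series (fun k => Cmod (a k)) -> cseries a l ->
  Cmod (csum a n - l) <= Series (fun k => Cmod (a k)) - rsum (fun k => Cmod (a k)) n.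
Proof.
  intros Habs Hl.
  apply cseries_Cmod in Hl.
  set (A := fun k => Cmod (a k)) in *.
  assert (Hm : forall m, Cmod (csum a n - l)
     <= Cmod (csum a (m + n) - l) + (Series A - rsum A n)).
  { intros m.
    replace (csum a n - l)%C with
      ((csum a (m + n) - l) + - (csum a (m + n) - csum a n))%C by ring.
    eapply Rle_trans; [apply Cmod_triangle|]. rewrite Cmod_opp.
    assert (Cmod (csum a (m + n) - csum a n) <= rsum A (m + n) - rsum A n).
    { induction m as [|m IH]; simpl.
      - replace (csum a n - csum a n)%C with (RtoC 0) by ring.
        rewrite Cmod_0; lra.
      - rewrite csum_S, rsum_S.
        replace (csum a (m + n) + a (S (m + n)) - csum a n)%C with
          ((csum a (m + n) - csum a n) + a (S (m + n)))%C by ring.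
        eapply Rle_trans; [apply Cmod_triangle|].
        unfold A at 2. lra. }
    assert (rsum A (m + n) <= Series A)
      by (apply rsum_le_Series; [intros; apply Cmod_ge_0|exact Habs]).
    lra. }
  assert (H : Rbar_le (Cmod (csum a n - l)) (0 + (Series A - rsum A n))).
  { apply (is_lim_seq_le (fun _ => Cmod (csum a n - l))
       (fun m => Cmod (csum a (m + n) - l) + (Series A - rsum A n))); auto.
    - apply is_lim_seq_const.
    - apply is_lim_seq_plus'; [|apply is_lim_seq_const].
      apply (is_lim_seq_incr_n (fun k => Cmod (csum a k - l)) n). exact Hl. }
  simpl in H. lra.
Qed.

Lemma cseries_Cmod_le (a : nat -> C) (l : C) :
  ex_series (fun k => Cmod (a k)) -> cseries a l ->
  Cmod l <= Series (fun k => Cmod (a k)).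
Proof.
  intros Habs Hl. pose proof (cseries_Cmod_tail a l 0 Habs Hl) as H.
  rewrite ?rsum_0, ?csum_0 in H.
  replace l with (a 0%nat + - (a 0%nat - l))%C by ring.
  eapply Rle_trans; [apply Cmod_triangle|]. rewrite Cmod_opp. lra.
Qed.

Lemma rsum_lim (u : nat -> nat -> R) (l : nat -> R) (N : nat) :
  (forall i, is_lim_seq (u i) (l i)) ->
  is_lim_seq (fun K => rsum (fun i => u i K) N) (rsum l N).
Proof.
  intros H. induction N as [|N IH].
  - rewrite ?rsum_0, ?csum_0. eapply is_lim_seq_ext; [|apply (H 0%nat)].
    intros K. now rewrite ?rsum_0, ?csum_0.
  - rewrite rsum_S. eapply is_lim_seq_ext.
    2: apply is_lim_seq_plus'; [exact IH|apply (H (S N))].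
    intros K. now rewrite rsum_S.
Qed.

(** Fubini for a triangular array: summation by rows and by columns gives the same [l]. Both are
    compared with the square blocks, whose moduli are bounded by [S]. *)
Lemma triangle_sum (u : nat -> nat -> C) (S : R) :
  (forall i k, (k < i)%nat -> u i k = RtoC 0) ->
  (forall N, rsum (fun i => rsum (fun k => Cmod (u i k)) N) N <= S) ->
  exists (r : nat -> C) (l : C),
    (forall i, cseries (u i) (r i)) /\
    cseries r l /\
    cseries (fun k => csum (fun i => u i k) k) l.
Proof.
  intros Htri HS.
  assert (Hnn : forall i n, 0 <= rsum (fun k => Cmod (u i k)) n)
    by (intros; apply rsum_nonneg; intros; apply Cmod_ge_0).
  assert (Hrow : forall i, ex_series (fun k => Cmod (u i k))).
  { intros i. apply (series_nonneg_bounded _ S); [intros; apply Cmod_ge_0|].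
    intros n. set (N := Nat.max i n).
    apply Rle_trans with (rsum (fun k => Cmod (u i k)) N).
    - apply rsum_incr; [intros; apply Cmod_ge_0|lia].
    - eapply Rle_trans; [|apply (HS N)].
      apply (rsum_term_le (fun i => rsum (fun k => Cmod (u i k)) N)); auto; lia. }
  assert (Hr : forall i, {r | cseries (u i) r})
    by (intros i; apply constructive_indefinite_description, cseries_of_abs, Hrow).
  set (r := fun i => proj1_sig (Hr i)).
  assert (Hr' : forall i, cseries (u i) (r i)) by (intros; apply (proj2_sig (Hr i))).
  set (B := fun i => Series (fun k => Cmod (u i k))).
  set (A := fun N => rsum (fun i => rsum (fun k => Cmod (u i k)) N) N).
  assert (HB0 : forall i, 0 <= B i).
  { intros i. eapply Rle_trans; [apply (Hnn i 0%nat)|].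
    apply rsum_le_Series; [intros; apply Cmod_ge_0|apply Hrow]. }
  assert (HlimB : forall N, is_lim_seq
     (fun K => rsum (fun i => rsum (fun k => Cmod (u i k)) K) N) (rsum B N)).
  { intros N. apply (rsum_lim (fun i K => rsum (fun k => Cmod (u i k)) K)).
    intros i. apply (Series_correct _ (Hrow i)). }
  assert (Hcol : forall N K, (N <= K)%nat ->
     rsum (fun i => rsum (fun k => Cmod (u i k)) K) N <= A K)
    by (intros; apply rsum_incr; auto).
  assert (Hincr : forall N, A N <= A (Datatypes.S N)).
  { intros N. eapply Rle_trans; [|apply (Hcol N (Datatypes.S N)); lia].
    apply rsum_le_loc. intros i _. apply rsum_incr; [intros; apply Cmod_ge_0|lia]. }
  destruct (ex_finite_lim_seq_incr A S Hincr HS) as [LA HLA].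
  assert (HA : forall N, rsum B N <= LA).
  { intros N.
    apply (is_lim_seq_le_loc
      (fun K => rsum (fun i => rsum (fun k => Cmod (u i k)) K) N) A (rsum B N) LA);
      auto.
    exists N. intros K HK. now apply Hcol. }
  destruct (series_nonneg_bounded B LA HB0 HA) as [HexB HleB].
  assert (Hrabs : ex_series (fun i => Cmod (r i))).
  { apply (@ex_series_le R_AbsRing R_CompleteNormedModule _ B); [|exact HexB].
    intros i. unfold norm; simpl. unfold abs; simpl.
    rewrite Rabs_pos_eq by apply Cmod_ge_0.
    apply cseries_Cmod_le; auto. }
  destruct (cseries_of_abs r Hrabs) as [l Hl].
  exists r, l. split; [exact Hr'|]. split; [exact Hl|].
  apply cseries_Cmod.
  (* Column [k] vanishes below row [k], so extending the columns down to row [K] fills the square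
     block without changing the sum. *)
  assert (Hsw : forall K, csum (fun k => csum (fun i => u i k) k) K
     = csum (fun i => csum (u i) K) K).
  { intros K.
    transitivity (csum (fun k => csum (fun i => u i k) K) K);
      [|symmetry; exact (sum_n_switch u K K)].
    apply csum_ext. intros k Hk.
    induction Hk as [|m Hm IH]; [reflexivity|].
    rewrite csum_S, <- IH. rewrite (Htri (Datatypes.S m) k) by lia. ring. }
  (* [rsum B K - A K] is the mass of moduli that the first rows carry beyond column [K]; both of its
     terms tend to [LA]. *)
  apply (is_lim_seq_le_le (fun _ => 0) _
    (fun K => (rsum B K - A K) + Cmod (csum r K - l))).
  - intros K. split; [apply Cmod_ge_0|].
    rewrite Hsw.
    replace (csum (fun i => csum (u i) K) K - l)%C with
      ((csum (fun i => csum (u i) K) K - csum r K) + (csum r K - l))%C by ring.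
    eapply Rle_trans; [apply Cmod_triangle|].
    apply Rplus_le_compat_r. rewrite <- csum_minus.
    eapply Rle_trans; [apply Cmod_csum|].
    eapply Rle_trans.
    + apply rsum_le_loc. intros i _. apply (cseries_Cmod_tail (u i) (r i) K); auto.
    + apply Req_le. apply (rsum_minus B).
  - apply is_lim_seq_const.
  - replace 0 with ((LA - LA) + 0) by ring.
    apply is_lim_seq_plus'; [|now apply cseries_Cmod].
    apply is_lim_seq_minus'; [|exact HLA].
    assert (Heq : Series B = LA).
    { apply Rle_antisym; [exact HleB|].
      apply (is_lim_seq_le A (rsum B) LA (Series B)); auto.
      - intros N. apply rsum_le_loc. intros i _.
        apply rsum_le_Series; [intros; apply Cmod_ge_0|apply Hrow].
      - apply (Series_correct _ HexB). }
    rewrite <- Heq. apply (Series_correct _ HexB).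
Qed.

(** * Power series and averages over roots of unity *)

Lemma cseries_terms_bounded (a : nat -> C) (l : C) :
  cseries a l -> exists M, forall n, Cmod (a n) <= M.
Proof.
  intros H. apply cseries_Cmod in H.
  assert (Hb : exists M, forall n, Cmod (csum a n - l) <= M).
  { apply is_lim_seq_spec in H. destruct (H (mkposreal 1 Rlt_0_1)) as [N HN].
    simpl in HN.
    exists (1 + rsum (fun n => Cmod (csum a n - l)) N). intros n.
    assert (Hs : 0 <= rsum (fun n => Cmod (csum a n - l)) N)
      by (apply rsum_nonneg; intros; apply Cmod_ge_0).
    destruct (le_lt_dec N n) as [Hn|Hn].
    - specialize (HN n Hn). rewrite Rminus_0_r, Rabs_pos_eq in HN by apply Cmod_ge_0.
      lra.
    - assert (Cmod (csum a n - l) <= rsum (fun n => Cmod (csum a n - l)) N).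
      { apply (rsum_term_le (fun n => Cmod (csum a n - l)));
          [intros; apply Cmod_ge_0|lia]. }
      lra. }
  destruct Hb as [M HM]. exists (M + M + Cmod (a 0%nat)). intros n.
  assert (HM0 := HM 0%nat). assert (H0 := Cmod_ge_0 (csum a 0 - l)).
  destruct n as [|n]; [lra|].
  replace (a (S n)) with ((csum a (S n) - l) + - (csum a n - l))%C
    by (rewrite csum_S; ring).
  eapply Rle_trans; [apply Cmod_triangle|]. rewrite Cmod_opp.
  pose proof (HM (S n)). pose proof (HM n). pose proof (Cmod_ge_0 (a 0%nat)). lra.
Qed.

(** Abel's lemma, by comparison with the geometric series of ratio [x / s]. *)
Lemma ex_series_geom_bounded (a : nat -> R) (M s x : R) :
  (forall k, 0 <= a k) -> (forall k, a k * s ^ k <= M) -> 0 <= x < s ->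
  ex_series (fun k => a k * x ^ k).
Proof.
  intros Ha HM Hx.
  apply (@ex_series_le R_AbsRing R_CompleteNormedModule _
           (fun k => scal M ((x / s) ^ k))).
  - intros k. unfold norm; simpl. unfold abs, scal; simpl. unfold mult; simpl.
    rewrite Rabs_pos_eq by (apply Rmult_le_pos; [apply Ha|apply pow_le; lra]).
    replace (x ^ k) with (s ^ k * (x / s) ^ k)
      by (rewrite <- Rpow_mult_distr; f_equal; field; lra).
    rewrite <- Rmult_assoc. apply Rmult_le_compat_r; [|apply HM].
    apply pow_le. apply Rdiv_le_0_compat; lra.
  - apply (@ex_series_scal R_AbsRing R_NormedModule), ex_series_geom.
    rewrite Rabs_pos_eq by (apply Rdiv_le_0_compat; lra).
    apply Rlt_div_l; lra.
Qed.

(** Common form of [taylor_on_disk] and [power_series_at], with the radius as a parameter so that it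
    can shrink or grow. *)
Definition disk_series (rho : R) (a : nat -> C) (f : C -> C) : Prop :=
  forall z, Cmod z < rho -> cseries (fun k => a k * z ^ k)%C (f z).

Lemma taylor_disk_series (f : C -> C) (a : nat -> C) :
  taylor_on_disk f a <-> disk_series 1 a f.
Proof. split; intros H z Hz; apply is_pseries_C; now apply H. Qed.

Lemma power_series_at_disk_series (f : C -> C) (z0 : C) (r : R) (a : nat -> C) :
  power_series_at f z0 r a <-> disk_series r a (fun h => f (z0 + h)%C).
Proof. split; intros H z Hz; apply is_pseries_C; now apply H. Qed.

Lemma disk_series_abs (rho : R) (a : nat -> C) (f : C -> C) (x : R) :
  disk_series rho a f -> 0 <= x < rho -> ex_series (fun k => Cmod (a k) * x ^ k).
Proof.
  intros H Hx. set (s := (x + rho) / 2).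
  assert (Hs : x < s < rho) by (unfold s; lra).
  assert (Hm : Cmod (RtoC s) = s) by (rewrite Cmod_R; apply Rabs_pos_eq; lra).
  destruct (cseries_terms_bounded _ _ (H (RtoC s) ltac:(rewrite Hm; lra))) as [M HM].
  apply (ex_series_geom_bounded _ M s); [intros; apply Cmod_ge_0| |lra].
  intros k. specialize (HM k). rewrite Cmod_mult, Cmod_pow, Hm in HM. exact HM.
Qed.

Lemma disk_series_abs_at (rho : R) (a : nat -> C) (f : C -> C) (z : C) :
  disk_series rho a f -> Cmod z < rho -> ex_series (fun k => Cmod (a k * z ^ k)).
Proof.
  intros H Hz. pose proof (Cmod_ge_0 z).
  eapply ex_series_ext; [|apply (disk_series_abs rho a f (Cmod z) H); lra].
  intros k. now rewrite Cmod_mult, Cmod_pow.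
Qed.

Lemma disk_series_le (rho rho' : R) (a : nat -> C) (f : C -> C) :
  rho' <= rho -> disk_series rho a f -> disk_series rho' a f.
Proof. intros Hr H z Hz. apply H. lra. Qed.

(** On coefficients this is multiplication by z^i. It also pads the rows of an array into the
    triangular shape required by [triangle_sum]. *)
Definition delay {T} (x0 : T) (i : nat) (a : nat -> T) (k : nat) : T :=
  if (k <? i)%nat then x0 else a (k - i)%nat.

Lemma delay_S {T} (x0 : T) (i : nat) (a : nat -> T) (k : nat) :
  delay x0 (S i) a (S k) = delay x0 i a k.
Proof.
  unfold delay. change (S k <? S i)%nat with (k <? i)%nat. now simpl.
Qed.

Lemma csum_delay (i : nat) (a : nat -> C) (n : nat) :
  csum (delay (RtoC 0) i a) (n + i) = csum a n.
Proof.
  induction i as [|i IH].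
  - rewrite Nat.add_0_r. apply csum_ext. intros k _. unfold delay; simpl.
    now rewrite Nat.sub_0_r.
  - rewrite Nat.add_succ_r, csum_shift, <- IH.
    unfold delay at 1; simpl. rewrite Cplus_0_l.
    apply csum_ext. intros k _. apply delay_S.
Qed.

Lemma rsum_delay (i : nat) (a : nat -> R) (n : nat) :
  rsum (delay 0 i a) (n + i) = rsum a n.
Proof.
  induction i as [|i IH].
  - rewrite Nat.add_0_r. apply rsum_ext. intros k _. unfold delay; simpl.
    now rewrite Nat.sub_0_r.
  - rewrite Nat.add_succ_r, rsum_shift, <- IH.
    unfold delay at 1; simpl. rewrite Rplus_0_l.
    apply rsum_ext. intros k _. apply delay_S.
Qed.

Lemma cseries_delay (i : nat) (a : nat -> C) (l : C) :
  cseries a l -> cseries (delay (RtoC 0) i a) l.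
Proof.
  rewrite !cseries_Cmod. intros H.
  apply (is_lim_seq_incr_n _ i).
  eapply is_lim_seq_ext; [|exact H].
  intros n. now rewrite csum_delay.
Qed.

Lemma rsum_delay_le (i : nat) (a : nat -> R) (n : nat) :
  (forall k, 0 <= a k) -> rsum (delay 0 i a) n <= rsum a n.
Proof.
  intros Ha. rewrite <- (rsum_delay i a n). apply rsum_incr; [|lia].
  intros k. unfold delay. destruct (k <? i)%nat; [lra|apply Ha].
Qed.

Lemma cseries_scal (c : C) (a : nat -> C) (l : C) :
  cseries a l -> cseries (fun k => c * a k)%C (c * l)%C.
Proof. exact (@is_series_scal C_AbsRing C_NormedModule c a l). Qed.

Lemma cseries_plus (a b : nat -> C) (la lb : C) :
  cseries a la -> cseries b lb -> cseries (fun k => a k + b k)%C (la + lb)%C.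
Proof. exact (@is_series_plus C_AbsRing C_NormedModule a b la lb). Qed.

Lemma cseries_ext (a b : nat -> C) (l : C) :
  (forall n, a n = b n) -> cseries a l -> cseries b l.
Proof. exact (@is_series_ext C_AbsRing C_NormedModule a b l). Qed.

Definition conv (a b : nat -> C) (k : nat) : C :=
  csum (fun i => a i * b (k - i)%nat)%C k.

(** Row [i] of the array is the second series multiplied by the [i]-th term of the first and delayed
    by [i]; the column sums are then the terms of the Cauchy product. *)
Lemma disk_series_mult (rho : R) (a b : nat -> C) (f g : C -> C) :
  disk_series rho a f -> disk_series rho b g ->
  disk_series rho (conv a b) (fun z => f z * g z)%C.
Proof.
  intros Hf Hg z Hz.
  pose proof (disk_series_abs_at rho a f z Hf Hz) as Ha.
  pose proof (disk_series_abs_at rho b g z Hg Hz) as Hb.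
  set (A := fun k => (a k * z ^ k)%C) in *. set (B := fun k => (b k * z ^ k)%C) in *.
  set (u := fun i => delay (RtoC 0) i (fun k => A i * B k)%C).
  assert (HA0 : forall k, 0 <= Cmod (A k)) by (intros; apply Cmod_ge_0).
  assert (HB0 : forall k, 0 <= Cmod (B k)) by (intros; apply Cmod_ge_0).
  assert (HSB : 0 <= Series (fun k => Cmod (B k)))
    by (eapply Rle_trans; [apply (rsum_nonneg _ 0 HB0)|now apply rsum_le_Series]).
  destruct (triangle_sum u (Series (fun k => Cmod (A k)) * Series (fun k => Cmod (B k))))
    as [r [l [H1 [H2 H3]]]].
  - intros i k Hk. unfold u, delay. apply Nat.ltb_lt in Hk. now rewrite Hk.
  - intros N.
    apply Rle_trans with (rsum (fun i => Series (fun k => Cmod (B k)) * Cmod (A i)) N).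
    + apply rsum_le_loc. intros i _.
      rewrite (rsum_ext _ (delay 0 i (fun k => Cmod (A i) * Cmod (B k)))).
      * eapply Rle_trans; [apply rsum_delay_le; intros; now apply Rmult_le_pos|].
        rewrite rsum_scal, Rmult_comm. apply Rmult_le_compat_r; [apply HA0|].
        now apply rsum_le_Series.
      * intros k _. unfold u, delay. destruct (k <? i)%nat; [apply Cmod_0|].
        apply Cmod_mult.
    + rewrite rsum_scal, Rmult_comm. apply Rmult_le_compat_r; [exact HSB|].
      now apply rsum_le_Series.
  - assert (Hr : forall i, r i = (g z * A i)%C).
    { intros i. apply (cseries_unique (u i)); [apply H1|].
      unfold u. apply cseries_delay. rewrite Cmult_comm.
      apply cseries_scal, Hg, Hz. }
    assert (Hl : l = (f z * g z)%C).
    { apply (cseries_unique r); [exact H2|]. rewrite Cmult_comm.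
      eapply cseries_ext; [intros; symmetry; apply Hr|].
      apply cseries_scal, Hf, Hz. }
    rewrite <- Hl. eapply cseries_ext; [|exact H3].
    intros k. unfold conv. simpl.
    rewrite Cmult_comm, <- csum_scal. apply csum_ext. intros i Hi.
    unfold u, delay. destruct (Nat.ltb_spec k i); [lia|].
    unfold A, B. replace (z ^ k)%C with (z ^ (i + (k - i)))%C by (f_equal; lia).
    rewrite Cpow_add_r. ring.
Qed.

(** * Discrete Fourier analysis on the circle *)

Definition expi (t : R) : C := (cos t, sin t).

Lemma Cmod_expi (t : R) : Cmod (expi t) = 1.
Proof.
  unfold Cmod, expi; simpl. transitivity (sqrt 1); [f_equal|apply sqrt_1].
  pose proof (sin2_cos2 t) as H. unfold Rsqr in H. transitivity (sin t * sin t + cos t * cos t); [ring|exact H].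
Qed.

Lemma expi_pow (t : R) (n : nat) : (expi t ^ n)%C = expi (INR n * t).
Proof.
  induction n as [|n IH].
  - simpl. unfold expi. now rewrite Rmult_0_l, cos_0, sin_0.
  - rewrite Cpow_S, IH, S_INR, Rmult_plus_distr_r, Rmult_1_l, Rplus_comm.
    unfold expi. rewrite cos_plus, sin_plus. unfold Cmult; simpl.
    f_equal; ring.
Qed.

Lemma csum_geom (q : C) (p : nat) :
  ((1 - q) * csum (fun j => q ^ j) p = 1 - q ^ S p)%C.
Proof.
  induction p as [|p IH].
  - rewrite csum_0. simpl. ring.
  - rewrite csum_S, Cmult_plus_distr_l, IH, !Cpow_S. ring.
Qed.

(** The order of the roots is [S p] because sums up to [p] have p + 1 terms. *)
Definition root_angle (p j : nat) : R := INR j * (2 * PI / INR (S p)).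

Lemma roots_of_unity_sum (p d : nat) :
  (0 < d <= p)%nat -> csum (fun j => expi (root_angle p j) ^ d)%C p = RtoC 0.
Proof.
  intros Hd.
  assert (Hp : 0 < INR (S p)) by (apply lt_0_INR; lia).
  assert (Hd0 : 0 < INR d) by (apply lt_0_INR; lia).
  assert (Hdp : INR d < INR (S p)) by (apply lt_INR; lia).
  pose proof PI_RGT_0 as HPI.
  assert (Hp' : INR (S p) <> 0) by lra.
  set (q := expi (INR d * (2 * PI / INR (S p)))).
  rewrite (csum_ext _ (fun j => q ^ j)%C).
  - assert (Hq : (q ^ S p)%C = RtoC 1).
    { unfold q. rewrite expi_pow.
      replace (INR (S p) * (INR d * (2 * PI / INR (S p)))) with (0 + 2 * INR d * PI)
        by (field; exact Hp').
      unfold expi. now rewrite cos_period, sin_period, cos_0, sin_0. }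
    (* If q were 1, the sine of the half angle pi d / (p + 1) would vanish, but this angle lies
       strictly between 0 and pi. *)
    assert (Hq1 : (1 - q)%C <> RtoC 0).
    { intros E. assert (Ec : 1 - cos (INR d * (2 * PI / INR (S p))) = 0)
        by exact (f_equal fst E).
      replace (INR d * (2 * PI / INR (S p))) with (2 * (INR d * PI / INR (S p))) in Ec
        by (field; exact Hp').
      rewrite cos_2a_sin in Ec.
      assert (0 < sin (INR d * PI / INR (S p))).
      { apply sin_gt_0.
        - apply Rdiv_lt_0_compat; [|lra]. now apply Rmult_lt_0_compat.
        - apply Rlt_div_l; [lra|]. rewrite Rmult_comm.
          now apply Rmult_lt_compat_l. }
      nra. }
    pose proof (csum_geom q p) as E. rewrite Hq in E.
    replace (1 - 1)%C with (RtoC 0) in E by ring.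
    destruct (Ceq_dec (csum (fun j => q ^ j)%C p) 0) as [H|H]; [exact H|].
    exfalso. now apply (Cmult_neq_0 _ _ Hq1 H).
  - intros j _. unfold q, root_angle. rewrite !expi_pow. f_equal. ring.
Qed.

Lemma unit_mult_conj (w : C) : Cmod w = 1 -> (w * Cconj w)%C = RtoC 1.
Proof. intros H. rewrite <- Cmod2_conj, H. f_equal; lra. Qed.

Lemma Cmod2_plus (x y : C) :
  Cmod (x + y) ^ 2 = Cmod x ^ 2 + Cmod y ^ 2 + 2 * Re (x * Cconj y).
Proof.
  rewrite !Cmod2_alt. destruct x as [x1 x2], y as [y1 y2]; simpl. ring.
Qed.

Lemma Re_csum (a : nat -> C) (n : nat) :
  Re (csum a n) = rsum (fun k => Re (a k)) n.
Proof.
  induction n as [|n IH].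
  - now rewrite csum_0, rsum_0.
  - now rewrite csum_S, rsum_S, re_plus, IH.
Qed.

Lemma Cconj_csum (a : nat -> C) (n : nat) :
  Cconj (csum a n) = csum (fun k => Cconj (a k)) n.
Proof.
  induction n as [|n IH].
  - now rewrite !csum_0.
  - now rewrite !csum_S, Cplus_conj, IH.
Qed.

Lemma rsum_plus (a b : nat -> R) (n : nat) :
  rsum (fun k => a k + b k) n = rsum a n + rsum b n.
Proof. exact (sum_n_plus a b n). Qed.

Lemma rsum_const (c : R) (n : nat) : rsum (fun _ => c) n = INR (S n) * c.
Proof. exact (sum_n_const n c). Qed.

(** Distinct exponents up to [p] differ by at least 1 and at most [p], so the corresponding powers
    are orthogonal on the p + 1 roots. Adding the term of degree [S L] thus creates only cross terms
    of average zero. *)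
Lemma discrete_parseval (a : nat -> C) (L p : nat) :
  (L <= p)%nat ->
  rsum (fun j => Cmod (csum (fun k => a k * expi (root_angle p j) ^ k)%C L) ^ 2) p
  = INR (S p) * rsum (fun k => Cmod (a k) ^ 2) L.
Proof.
  intros HL. induction L as [|L IH].
  - rewrite rsum_0. rewrite <- rsum_const. apply rsum_ext. intros j _.
    rewrite csum_0. simpl. now rewrite Cmult_1_r.
  - rewrite rsum_S, Rmult_plus_distr_l, <- IH by lia.
    rewrite <- rsum_const, <- rsum_plus.
    set (w := fun j => expi (root_angle p j)).
    assert (Hw : forall j, Cmod (w j) = 1) by (intros; apply Cmod_expi).
    assert (Hcross : csum (fun j => csum (fun k => a k * w j ^ k)%C L
                              * Cconj (a (S L) * w j ^ S L))%C p = RtoC 0).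
    { rewrite (csum_ext _ (fun j => csum (fun k => (a k * Cconj (a (S L)))
                               * Cconj (w j ^ (S L - k)))%C L)).
      - transitivity (csum (fun k => csum (fun j => (a k * Cconj (a (S L)))
                               * Cconj (w j ^ (S L - k)))%C p) L).
        { exact (sum_n_switch (fun j k => (a k * Cconj (a (S L)))
                               * Cconj (w j ^ (S L - k)))%C p L). }
        apply csum_zero. intros k Hk.
        rewrite csum_scal, <- Cconj_csum. unfold w.
        rewrite roots_of_unity_sum by lia.
        replace (Cconj 0) with (RtoC 0) by (unfold Cconj, RtoC; simpl; f_equal; ring).
        ring.
      - intros j _. rewrite Cmult_comm, <- csum_scal. apply csum_ext. intros k Hk.
        rewrite Cmult_conj.
        replace (w j ^ S L)%C with (w j ^ k * w j ^ (S L - k))%C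
          by (rewrite <- Cpow_add_r; f_equal; lia).
        rewrite Cmult_conj.
        transitivity ((a k * Cconj (a (S L))) * Cconj (w j ^ (S L - k))
                       * ((w j) ^ k * Cconj ((w j) ^ k)))%C; [ring|].
        rewrite unit_mult_conj; [ring|]. rewrite Cmod_pow, Hw. apply pow1. }
    apply (f_equal Re) in Hcross. rewrite Re_csum in Hcross.
    rewrite (rsum_ext _ (fun j => (Cmod (csum (fun k => a k * w j ^ k)%C L) ^ 2
        + Cmod (a (S L)) ^ 2) + 2 * Re (csum (fun k => a k * w j ^ k)%C L
                              * Cconj (a (S L) * w j ^ S L)))).
    + rewrite rsum_plus, rsum_scal, Hcross. unfold Re, RtoC, fst. unfold w; ring.
    + intros j _. rewrite csum_S, Cmod2_plus, (Cmod_mult (a (S L))), Cmod_pow.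
      fold (w j). rewrite Hw, pow1, Rmult_1_r. reflexivity.
Qed.

(** Truncating the series of [G] at order [M] costs at most [eps M] uniformly on the circle. The
    exact average applies to the truncation, and [M] then tends to infinity. *)
Lemma circle_domination (a h : nat -> C) (G : C -> C) (K L : nat) :
  ex_series (fun k => Cmod (a k)) ->
  (forall w, Cmod w = 1 -> cseries (fun k => a k * w ^ k)%C (G w)) ->
  (forall w, Cmod w = 1 -> Cmod (G w) <= Cmod (csum (fun k => h k * w ^ k)%C L)) ->
  rsum (fun k => Cmod (a k) ^ 2) K <= rsum (fun k => Cmod (h k) ^ 2) L.
Proof.
  intros Ha HG Hdom.
  set (B := rsum (fun k => Cmod (h k)) L).
  assert (HB0 : 0 <= B) by (apply rsum_nonneg; intros; apply Cmod_ge_0).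
  assert (Hterm : forall (c : nat -> C) w, Cmod w = 1 ->
      forall k, Cmod (c k * w ^ k) = Cmod (c k))
    by (intros c w Hw k; rewrite Cmod_mult, Cmod_pow, Hw, pow1; ring).
  assert (HB : forall w, Cmod w = 1 -> Cmod (csum (fun k => h k * w ^ k)%C L) <= B).
  { intros w Hw. eapply Rle_trans; [apply Cmod_csum|]. apply rsum_le_loc.
    intros k _. rewrite (Hterm h w Hw). lra. }
  set (eps := fun M => Series (fun k => Cmod (a k)) - rsum (fun k => Cmod (a k)) M).
  assert (Heps0 : forall M, 0 <= eps M).
  { intros M. unfold eps.
    assert (rsum (fun k => Cmod (a k)) M <= Series (fun k => Cmod (a k)))
      by (apply rsum_le_Series; [intros; apply Cmod_ge_0|exact Ha]). lra. }
  assert (Htail : forall M w, Cmod w = 1 ->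
      Cmod (csum (fun k => a k * w ^ k)%C M) <= Cmod (G w) + eps M).
  { intros M w Hw.
    assert (Hab : ex_series (fun k => Cmod (a k * w ^ k)%C))
      by (eapply ex_series_ext; [|exact Ha]; intros k; now rewrite (Hterm a w Hw)).
    pose proof (cseries_Cmod_tail _ _ M Hab (HG w Hw)) as Ht.
    rewrite (Series_ext _ (fun k => Cmod (a k))) in Ht by apply (Hterm a w Hw).
    rewrite (rsum_ext _ (fun k => Cmod (a k))) in Ht
      by (intros; apply (Hterm a w Hw)).
    replace (csum (fun k => a k * w ^ k) M)%C
      with (G w + (csum (fun k => a k * w ^ k) M - G w))%C by ring.
    eapply Rle_trans; [apply Cmod_triangle|]. unfold eps. lra. }
  assert (Hmain : forall M, (K <= M)%nat ->
     rsum (fun k => Cmod (a k) ^ 2) K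
     <= rsum (fun k => Cmod (h k) ^ 2) L + (2 * B * eps M + eps M * eps M)).
  (* This order makes the average exact both for the truncation and for the dominating
     polynomial. *)
  { intros M HM. set (p := (M + L)%nat).
    assert (Hp : 0 < INR (S p)) by (apply lt_0_INR; lia).
    apply Rle_trans with (rsum (fun k => Cmod (a k) ^ 2) M);
      [apply rsum_incr; [intros; apply pow2_ge_0|exact HM]|].
    apply Rmult_le_reg_l with (INR (S p)); [exact Hp|].
    rewrite Rmult_plus_distr_l.
    rewrite <- (discrete_parseval a M p), <- (discrete_parseval h L p) by (unfold p; lia).
    rewrite <- rsum_const, <- rsum_plus. apply rsum_le_loc. intros j _.
    set (w := expi (root_angle p j)).
    assert (Hw : Cmod w = 1) by apply Cmod_expi.
    pose proof (Htail M w Hw). pose proof (Hdom w Hw). pose proof (HB w Hw).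
    pose proof (Heps0 M).
    pose proof (Cmod_ge_0 (csum (fun k => a k * w ^ k)%C M)).
    pose proof (Cmod_ge_0 (csum (fun k => h k * w ^ k)%C L)).
    set (x := Cmod (csum (fun k => a k * w ^ k)%C M)) in *.
    set (y := Cmod (csum (fun k => h k * w ^ k)%C L)) in *.
    assert (x ^ 2 <= (y + eps M) ^ 2) by (apply pow_incr; lra).
    assert (y * eps M <= B * eps M) by (apply Rmult_le_compat_r; lra).
    nra. }
  assert (Hlim : is_lim_seq eps 0).
  { replace 0 with (Series (fun k => Cmod (a k)) - Series (fun k => Cmod (a k))) by ring.
    apply is_lim_seq_minus'; [apply is_lim_seq_const|].
    apply (Series_correct _ Ha). }
  assert (Hlim2 : is_lim_seq (fun M => rsum (fun k => Cmod (h k) ^ 2) L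
      + (2 * B * eps M + eps M * eps M))
      (rsum (fun k => Cmod (h k) ^ 2) L + (2 * B * 0 + 0 * 0))).
  { apply is_lim_seq_plus'; [apply is_lim_seq_const|].
    apply is_lim_seq_plus'; apply is_lim_seq_mult'; auto; apply is_lim_seq_const. }
  pose proof (is_lim_seq_le_loc (fun _ => rsum (fun k => Cmod (a k) ^ 2) K) _ _ _
    (ex_intro _ K Hmain) (is_lim_seq_const _) Hlim2) as H.
  unfold Rbar_le in H. lra.
Qed.

Lemma coefficient_domination (rho r : R) (a h : nat -> C) (F : C -> C) (K L : nat) :
  disk_series rho a F -> 0 <= r < rho ->
  (forall z, Cmod z = r -> Cmod (F z) <= Cmod (csum (fun k => h k * z ^ k)%C L)) ->
  rsum (fun k => Cmod (a k) ^ 2 * (r ^ k) ^ 2) K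
  <= rsum (fun k => Cmod (h k) ^ 2 * (r ^ k) ^ 2) L.
Proof.
  intros Ha Hr Hdom.
  assert (Hmod : forall w, Cmod w = 1 -> Cmod (r * w) = r).
  { intros w Hw. rewrite Cmod_mult, Hw, Cmod_R, Rabs_pos_eq; lra. }
  assert (Hsc : forall (c : nat -> C) k, Cmod (c k * r ^ k) = Cmod (c k) * r ^ k).
  { intros c k. rewrite Cmod_mult, Cmod_pow, Cmod_R, Rabs_pos_eq; lra. }
  assert (Hsq : forall (c : nat -> C) n, rsum (fun k => Cmod (c k) ^ 2 * (r ^ k) ^ 2) n
     = rsum (fun k => Cmod (c k * r ^ k) ^ 2) n).
  { intros c n. apply rsum_ext. intros k _. rewrite Hsc. ring. }
  assert (Hev : forall (c : nat -> C) w k, (c k * r ^ k * w ^ k = c k * (r * w) ^ k)%C)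
    by (intros; rewrite Cpow_mult_l; ring).
  rewrite !Hsq.
  apply (circle_domination (fun k => a k * r ^ k)%C (fun k => h k * r ^ k)%C
           (fun w => F (r * w)%C)).
  - eapply ex_series_ext; [|apply (disk_series_abs rho a F r Ha Hr)].
    intros k. now rewrite Hsc.
  - intros w Hw. eapply cseries_ext; [intros k; symmetry; apply (Hev a)|].
    apply Ha. rewrite Hmod by exact Hw. lra.
  - intros w Hw. rewrite (csum_ext _ (fun k => h k * (r * w) ^ k)%C)
      by (intros; apply (Hev h)).
    apply Hdom, Hmod, Hw.
Qed.

(** Domination by the constant polynomial [M], keeping a single term of the sum of squares. *)
Lemma cauchy_estimate (rho r M : R) (a : nat -> C) (F : C -> C) (k : nat) :
  disk_series rho a F -> 0 <= r < rho ->
  (forall z, Cmod z = r -> Cmod (F z) <= M) -> Cmod (a k) * r ^ k <= M.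
Proof.
  intros Ha Hr HM.
  assert (HM0 : 0 <= M).
  { apply Rle_trans with (Cmod (F (RtoC r))); [apply Cmod_ge_0|].
    apply HM. rewrite Cmod_R, Rabs_pos_eq; lra. }
  assert (HMC : Cmod (RtoC M) = M) by (rewrite Cmod_R, Rabs_pos_eq; lra).
  pose proof (coefficient_domination rho r a (fun _ => RtoC M) F k 0 Ha Hr) as H.
  rewrite rsum_0, HMC in H.
  assert (Hk : (Cmod (a k) * r ^ k) ^ 2 <= M ^ 2).
  { apply Rle_trans with (rsum (fun k => Cmod (a k) ^ 2 * (r ^ k) ^ 2) k).
    - rewrite Rpow_mult_distr.
      apply (rsum_term_le (fun k => Cmod (a k) ^ 2 * (r ^ k) ^ 2)); [|lia].
      intros i. apply Rmult_le_pos; apply pow2_ge_0.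
    - replace (M ^ 2) with (M ^ 2 * (r ^ 0) ^ 2) by (simpl; ring).
      apply H. intros z Hz. rewrite csum_0. simpl. rewrite Cmult_1_r, HMC. auto. }
  apply Rsqr_incr_0_var; [|exact HM0]. unfold Rsqr. simpl in Hk. lra.
Qed.

(** * Global Taylor series *)

Lemma disk_series_ext (rho : R) (a : nat -> C) (f g : C -> C) :
  (forall z, Cmod z < rho -> f z = g z) -> disk_series rho a f -> disk_series rho a g.
Proof. intros H Hf z Hz. rewrite <- H by exact Hz. now apply Hf. Qed.

(** The difference of the two series represents 0, and Cauchy's estimate with bound 0 on the circle
    of radius [rho / 2] kills its coefficients. *)
Lemma disk_series_unique (rho : R) (a b : nat -> C) (f : C -> C) (k : nat) :
  0 < rho -> disk_series rho a f -> disk_series rho b f -> a k = b k.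
Proof.
  intros Hr Ha Hb.
  assert (Hd : disk_series rho (fun n => a n + (-(1)) * b n)%C (fun _ => RtoC 0)).
  { intros z Hz. replace (RtoC 0) with (f z + (-(1)) * f z)%C by ring.
    eapply cseries_ext; [|apply cseries_plus; [apply Ha, Hz|apply cseries_scal, Hb, Hz]].
    intros n. simpl. ring. }
  assert (Hk : Cmod (a k + (-(1)) * b k) * (rho / 2) ^ k <= 0).
  { apply (cauchy_estimate rho (rho / 2) 0 _ _ k Hd); [lra|].
    intros z _. rewrite Cmod_0; lra. }
  assert (Hp : 0 < (rho / 2) ^ k) by (apply pow_lt; lra).
  pose proof (Cmod_ge_0 (a k + (-(1)) * b k)) as H0.
  assert (E : Cmod (a k + (-(1)) * b k) = 0) by nra.
  apply Cmod_eq_0 in E.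
  replace (a k) with ((a k + (-(1)) * b k) + b k)%C by ring. rewrite E. ring.
Qed.

(* Unlike [Binomial.C], this vanishes for n > m. *)
Fixpoint choose (m n : nat) : R :=
  match m, n with
  | _, 0%nat => 1
  | 0%nat, S _ => 0
  | S m', S n' => choose m' n' + choose m' (S n')
  end.

Lemma choose_0 (m : nat) : choose m 0 = 1.
Proof. now destruct m. Qed.

Lemma choose_nonneg (m n : nat) : 0 <= choose m n.
Proof.
  revert n. induction m as [|m IH]; intros [|n]; simpl; try lra.
  pose proof (IH n). pose proof (IH (S n)). lra.
Qed.

Lemma choose_gt (m n : nat) : (m < n)%nat -> choose m n = 0.
Proof.
  revert n. induction m as [|m IH]; intros [|n] H; simpl; try lia; try lra.
  rewrite !IH by lia. ring.
Qed.

Lemma Cbinomial (w h : C) (m : nat) :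
  ((w + h) ^ m)%C = csum (fun n => choose m n * w ^ (m - n) * h ^ n)%C m.
Proof.
  induction m as [|m IH].
  - rewrite csum_0. simpl. ring.
  - set (T := fun n => (choose m n * w ^ (m - n) * h ^ n)%C) in *.
    assert (E : csum (fun n => T (S n)) m = (csum T m - T 0%nat)%C).
    { transitivity (csum T (S m) - T 0%nat)%C; [rewrite csum_shift; ring|].
      rewrite csum_S. unfold T at 2. rewrite choose_gt by lia. ring. }
    rewrite csum_shift, Cpow_S, IH, !choose_0.
    rewrite (csum_ext (fun n => choose (S m) (S n) * w ^ (S m - S n) * h ^ S n)%C
                      (fun n => h * T n + w * T (S n))%C).
    + rewrite csum_plus, !csum_scal, E.
      replace (T 0%nat) with (w ^ m)%C
        by (unfold T; rewrite choose_0, Nat.sub_0_r; simpl; ring).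
      rewrite Nat.sub_0_r, Cpow_S. simpl. ring.
    + intros n Hn. unfold T.
      change (choose (S m) (S n)) with (choose m n + choose m (S n)).
      rewrite RtoC_plus, Cpow_S. change (S m - S n)%nat with (m - n)%nat.
      destruct (Nat.eq_dec n m) as [->|Hne].
      * rewrite (choose_gt m (S m)) by lia. ring.
      * replace (m - n)%nat with (S (m - S n)) by lia. rewrite Cpow_S. ring.
Qed.

Lemma Rbinomial (x y : R) (m : nat) :
  (x + y) ^ m = rsum (fun n => choose m n * x ^ (m - n) * y ^ n) m.
Proof.
  apply RtoC_inj. rewrite RtoC_pow, RtoC_plus, Cbinomial, RtoC_rsum.
  apply csum_ext. intros n _. now rewrite !RtoC_mult, !RtoC_pow.
Qed.

Lemma cseries_undelay (i : nat) (a : nat -> C) (l : C) :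
  cseries (delay (RtoC 0) i a) l -> cseries a l.
Proof.
  rewrite !cseries_Cmod. intros H.
  apply (is_lim_seq_incr_n _ i) in H.
  eapply is_lim_seq_ext; [|exact H].
  intros n. simpl. now rewrite csum_delay.
Qed.

Lemma rsum_zero_tail (a : nat -> R) (n N : nat) :
  (forall k, (n < k)%nat -> a k = 0) -> (n <= N)%nat -> rsum a N = rsum a n.
Proof.
  intros H Hn. induction Hn as [|m Hm IH]; [reflexivity|].
  rewrite rsum_S, IH, H by lia. ring.
Qed.

(** [G n] is the n-th derivative of [F] divided by n!, obtained by expanding each (w + h)^m with the
    binomial theorem. Having [G n] as a power series in the centre [w] allows Cauchy estimates in
    [w] as well as in [h]. *)
Lemma recenter (rho : R) (a : nat -> C) (F : C -> C) :
  disk_series rho a F ->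
  exists G : nat -> C -> C,
    (forall n, disk_series rho (fun k => choose (n + k) n * a (n + k)%nat)%C (G n)) /\
    (forall w, Cmod w < rho ->
       disk_series (rho - Cmod w) (fun n => G n w) (fun h => F (w + h)%C)).
Proof.
  intros Ha.
  set (t := fun (w : C) n k => (choose (n + k) n * a (n + k)%nat * w ^ k)%C).
  assert (Hwh : forall w h, Cmod w + Cmod h < rho -> exists r : nat -> C,
    (forall n, cseries (fun k => h ^ n * t w n k)%C (r n)) /\ cseries r (F (w + h)%C)).
  { intros w h Hlt.
    pose proof (Cmod_ge_0 w) as Hw0. pose proof (Cmod_ge_0 h) as Hh0.
    set (x := Cmod w + Cmod h) in *.
    set (u := fun n => delay (RtoC 0) n (fun k => h ^ n * t w n k)%C).
    assert (Hu : forall n m, (n <= m)%nat ->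
       u n m = (a m * (choose m n * w ^ (m - n) * h ^ n))%C).
    { intros n m Hnm. unfold u, delay, t. destruct (Nat.ltb_spec m n); [lia|].
      replace (n + (m - n))%nat with m by lia. ring. }
    assert (Hu0 : forall n m, (m < n)%nat -> u n m = RtoC 0).
    { intros n m Hnm. unfold u, delay. apply Nat.ltb_lt in Hnm. now rewrite Hnm. }
    destruct (triangle_sum u (Series (fun m => Cmod (a m) * x ^ m)))
      as [r [l [H1 [H2 H3]]]].
    - exact Hu0.
    - intros N.
      apply Rle_trans with (rsum (fun m => Cmod (a m) * x ^ m) N).
      + apply Req_le.
        transitivity (rsum (fun m => rsum (fun n => Cmod (u n m)) N) N).
        { exact (sum_n_switch (fun n m => Cmod (u n m)) N N). }
        apply rsum_ext. intros m Hm.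
        rewrite (rsum_zero_tail _ m N);
          [|intros k Hk; rewrite Hu0 by exact Hk; apply Cmod_0|exact Hm].
        unfold x. rewrite Rbinomial, <- rsum_scal. apply rsum_ext.
        intros n Hn. rewrite Hu by exact Hn.
        rewrite !Cmod_mult, !Cmod_pow, Cmod_R, Rabs_pos_eq by apply choose_nonneg.
        reflexivity.
      + apply rsum_le_Series.
        * intros m. apply Rmult_le_pos; [apply Cmod_ge_0|apply pow_le; unfold x; lra].
        * apply (disk_series_abs rho a F); [exact Ha|]. unfold x in *; lra.
    - exists r. split.
      + intros n. apply (cseries_undelay n). apply H1.
      + replace (F (w + h)%C) with l; [exact H2|].
        apply (cseries_unique (fun m => a m * (w + h) ^ m)%C).
        * eapply cseries_ext; [|exact H3]. intros m. simpl.
          rewrite Cbinomial, <- csum_scal. apply csum_ext. intros n Hn.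
          now apply Hu.
        * apply Ha. pose proof (Cmod_triangle w h). unfold x in *; lra. }
  (* [Hwh] only sums the inner series multiplied by h^n: take for [h] a small positive real [s] and
     divide by s^n. Outside the disk the value is arbitrary. *)
  assert (Hex : forall n w, {g | Cmod w < rho -> cseries (t w n) g}).
  { intros n w. apply constructive_indefinite_description.
    destruct (Rlt_le_dec (Cmod w) rho) as [Hw|Hw]; [|exists w; intros; lra].
    set (s := (rho - Cmod w) / 2).
    assert (Hs : 0 < s) by (unfold s; lra).
    destruct (Hwh w (RtoC s)) as [r [H1 _]].
    { rewrite Cmod_R, Rabs_pos_eq by lra. unfold s; lra. }
    assert (Hsn : (RtoC s ^ n)%C <> RtoC 0).
    { apply Cpow_nz. intros E. apply RtoC_inj in E. lra. }
    exists (/ (RtoC s ^ n) * r n)%C. intros _.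
    eapply cseries_ext; [|apply cseries_scal, (H1 n)].
    intros k. simpl. field. exact Hsn. }
  exists (fun n w => proj1_sig (Hex n w)). split.
  - intros n w Hw. exact (proj2_sig (Hex n w) Hw).
  - intros w Hw h Hh.
    destruct (Hwh w h) as [r [H1 H2]]; [lra|].
    eapply cseries_ext; [|exact H2]. intros n. simpl.
    apply (cseries_unique (fun k => h ^ n * t w n k)%C); [apply H1|].
    rewrite Cmult_comm. apply cseries_scal. exact (proj2_sig (Hex n w) Hw).
Qed.

Lemma rsum_geom_le (q : R) (n : nat) : 0 <= q < 1 -> rsum (fun k => q ^ k) n <= / (1 - q).
Proof.
  intros Hq. assert (Hq' : Rabs q < 1) by (rewrite Rabs_pos_eq; lra).
  rewrite <- (Series_geom q Hq'). apply rsum_le_Series; [intros; apply pow_le; lra|].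
  now apply ex_series_geom.
Qed.

(* Each disk of radius d around a point of the circle |z| = r gives
   C(m,n) |a_m| r^(m-n) s^n <= 1 for s < d by two Cauchy estimates; summing over n
   shows that the radius of convergence of a is at least r + d. *)
Lemma series_extension (f : C -> C) (a : nat -> C) (R0 r d : R) :
  (forall z, Cmod z < 1 -> Cmod (f z) <= 1) ->
  disk_series R0 a f -> 0 < r < R0 -> 0 < d -> r + d <= 1 ->
  (forall z0, Cmod z0 = r -> exists b, disk_series d b (fun h => f (z0 + h)%C)) ->
  disk_series (r + d) a f.
Proof.
  intros Hf Ha Hr Hd Hrd Hloc.
  destruct (recenter R0 a f Ha) as [G [HG1 HG2]].
  assert (Hest : forall s m n, 0 < s < d -> (n <= m)%nat ->
     Cmod (a m) * (choose m n * r ^ (m - n) * s ^ n) <= 1).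
  { intros s m n Hs Hnm.
    assert (Hsn : 0 < s ^ n) by (apply pow_lt; lra).
    assert (HGb : forall z, Cmod z = r -> Cmod (G n z) <= / s ^ n).
    { intros z Hz. destruct (Hloc z Hz) as [b Hb].
      (* Re-expansion at [z] is known to represent [f] only up to radius [R0 - r]. Uniqueness
         identifies its coefficients with those of the local series, valid up to [d], and so permits
         the radius [s] in Cauchy's estimate. *)
      assert (E : b n = G n z).
      { apply (disk_series_unique (Rmin d (R0 - r)) b (fun n => G n z)
                 (fun h => f (z + h)%C)).
        - apply Rmin_glb_lt; lra.
        - eapply disk_series_le; [apply Rmin_l|exact Hb].
        - eapply disk_series_le; [apply Rmin_r|]. rewrite <- Hz. apply HG2. lra. }
      rewrite <- E.
      apply Rmult_le_reg_r with (s ^ n); [exact Hsn|].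
      rewrite Rinv_l by lra.
      apply (cauchy_estimate d s 1 b _ n Hb); [lra|].
      intros h Hh. apply Hf. pose proof (Cmod_triangle z h). lra. }
    pose proof (cauchy_estimate R0 r (/ s ^ n) _ _ (m - n) (HG1 n)
                  ltac:(lra) HGb) as H.
    simpl in H. replace (n + (m - n))%nat with m in H by lia.
    rewrite Cmod_mult, Cmod_R, Rabs_pos_eq in H by apply choose_nonneg.
    apply Rmult_le_compat_r with (r := s ^ n) in H; [|lra].
    rewrite Rinv_l in H by lra. lra. }
  assert (Habs : forall x, 0 <= x < r + d -> ex_series (fun m => Cmod (a m) * x ^ m)).
  { intros x Hx.
    (* [s'] puts [x] below [r + s'], and the gap between [s'] and [s] makes the powers of [s' / s]
       summable. *)
    assert (Hs : exists s' s, 0 < s' /\ s' < s /\ s < d /\ x < r + s').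
    { set (y := Rmax 0 (x - r)).
      assert (0 <= y) by apply Rmax_l. assert (x - r <= y) by apply Rmax_r.
      assert (y < d) by (apply Rmax_lub_lt; lra).
      exists (y + (d - y) / 3), (y + 2 * (d - y) / 3). repeat split; lra. }
    destruct Hs as [s' [s [Hs1 [Hs2 [Hs3 Hs4]]]]].
    apply (ex_series_geom_bounded _ (/ (1 - s' / s)) (r + s'));
      [intros; apply Cmod_ge_0| |lra].
    intros m.
    assert (Hq : 0 <= s' / s < 1).
    { split; [apply Rdiv_le_0_compat; lra|apply Rlt_div_l; lra]. }
    eapply Rle_trans; [|apply (rsum_geom_le (s' / s) m Hq)].
    rewrite Rbinomial, <- rsum_scal. apply rsum_le_loc. intros n Hn.
    replace (s' ^ n) with (s ^ n * (s' / s) ^ n)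
      by (rewrite <- Rpow_mult_distr; f_equal; field; lra).
    assert (Hqn : 0 <= (s' / s) ^ n) by (apply pow_le; lra).
    pose proof (Hest s m n ltac:(lra) Hn) as H.
    apply Rmult_le_compat_r with (r := (s' / s) ^ n) in H; lra. }
  assert (HP : forall z, {p | Cmod z < r + d -> cseries (fun k => a k * z ^ k)%C p}).
  { intros z. apply constructive_indefinite_description.
    destruct (Rlt_le_dec (Cmod z) (r + d)) as [Hz|Hz]; [|exists z; intros; lra].
    destruct (cseries_of_abs (fun k => a k * z ^ k)%C) as [p Hp]; [|now exists p].
    eapply ex_series_ext; [|apply (Habs (Cmod z)); split; [apply Cmod_ge_0|exact Hz]].
    intros k. now rewrite Cmod_mult, Cmod_pow. }
  set (P := fun z => proj1_sig (HP z)).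
  assert (HPa : disk_series (r + d) a P) by (intros z Hz; exact (proj2_sig (HP z) Hz)).
  assert (HPf : forall z, Cmod z < r + d -> Cmod z < R0 -> P z = f z).
  { intros z Hz1 Hz2. apply (cseries_unique (fun k => a k * z ^ k)%C);
      [now apply HPa|now apply Ha]. }
  apply (disk_series_ext _ _ P); [|exact HPa].
  intros z Hz. destruct (Rlt_le_dec (Cmod z) R0) as [Hz0|Hz0]; [now apply HPf|].
  (* Beyond [R0], project [z] radially to [z0] on the circle of radius [r], at distance less than
     [d]. There [P] and [f] both have expansions of radius [d], with equal coefficients because the
     two functions agree near [z0]. *)
  destruct (recenter (r + d) a P HPa) as [G' [_ HG']].
  assert (Hzp : 0 < Cmod z) by lra.
  set (q := r / Cmod z).
  assert (Hq : 0 < q < 1).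
  { split; [apply Rdiv_lt_0_compat; lra|apply Rlt_div_l; lra]. }
  set (z0 := (RtoC q * z)%C). set (h := (RtoC (1 - q) * z)%C).
  assert (Hqz : q * Cmod z = r) by (unfold q; field; lra).
  assert (Hmz0 : Cmod z0 = r)
    by (unfold z0; rewrite Cmod_mult, Cmod_R, Rabs_pos_eq by lra; exact Hqz).
  assert (Hmh : Cmod h < d).
  { unfold h. rewrite Cmod_mult, Cmod_R, Rabs_pos_eq by lra. nra. }
  assert (Hzz : z = (z0 + h)%C).
  { unfold z0, h. rewrite RtoC_minus. ring. }
  destruct (Hloc z0 Hmz0) as [b Hb].
  pose proof (HG' z0 ltac:(lra)) as HGz. rewrite Hmz0 in HGz.
  replace (r + d - r) with d in HGz by ring.
  assert (E : forall n, b n = G' n z0).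
  { intros n.
    apply (disk_series_unique (Rmin d (R0 - r)) b (fun n => G' n z0)
             (fun h => f (z0 + h)%C)).
    - apply Rmin_glb_lt; lra.
    - eapply disk_series_le; [apply Rmin_l|exact Hb].
    - apply (disk_series_ext _ _ (fun h => P (z0 + h)%C)).
      + intros k Hk. pose proof (Cmod_triangle z0 k).
        pose proof (Rmin_l d (R0 - r)). pose proof (Rmin_r d (R0 - r)).
        apply HPf; lra.
      + eapply disk_series_le; [apply Rmin_l|exact HGz]. }
  rewrite Hzz. apply (cseries_unique (fun n => b n * h ^ n)%C).
  - apply (cseries_ext (fun n => G' n z0 * h ^ n)%C); [|now apply HGz].
    intros n. now rewrite E.
  - now apply Hb.
Qed.

Lemma Cmod_lt_box (u v delta : R) :
  Rabs u < delta -> Rabs v < delta -> Cmod (u, v) < 2 * delta.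
Proof.
  intros Hu Hv. unfold Cmod; simpl.
  assert (Hd : 0 < delta) by (pose proof (Rabs_pos u); lra).
  apply Rabs_def2 in Hu. apply Rabs_def2 in Hv.
  rewrite <- (sqrt_square (2 * delta)) by lra.
  apply sqrt_lt_1; nra.
Qed.

(** A Lebesgue number for the covering by local disks, from compactness of the square [-1, 1]^2. *)
Lemma uniform_radius (f : C -> C) (R0 : R) :
  analytic_on_disk f -> 0 < R0 < 1 ->
  exists d, 0 < d /\ forall z0, Cmod z0 <= R0 ->
    exists b, disk_series d b (fun h => f (z0 + h)%C).
Proof.
  intros Hf HR.
  (* Coordinates within [delta] give a distance below 2 [delta], so a local radius of 4 [delta]
     leaves more than 2 [delta] after re-expansion. The gauge must also be defined at centres
     outside the unit disk; there it is so small that no point of modulus at most [R0] comes within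
     reach. *)
  assert (Hdelta : forall u v : R, {delta : posreal |
    (Cmod (u, v) < 1 -> exists b, disk_series (4 * delta) b (fun h => f ((u, v) + h)%C))
    /\ (1 <= Cmod (u, v) -> 2 * delta <= 1 - R0)}).
  { intros u v. apply constructive_indefinite_description.
    destruct (Rlt_le_dec (Cmod (u, v)) 1) as [H|H].
    - destruct (Hf (u, v) H) as [r [b [Hr Hb]]].
      assert (Hr4 : 0 < r / 4) by lra.
      exists (mkposreal _ Hr4). simpl. split; [intros _|intros; lra].
      exists b. apply power_series_at_disk_series in Hb.
      eapply disk_series_le; [|exact Hb]. lra.
    - assert (H2 : 0 < (1 - R0) / 2) by lra.
      exists (mkposreal _ H2). simpl. split; intros; lra. }
  destruct (compactness_value_2d (-1) 1 (-1) 1 (fun u v => proj1_sig (Hdelta u v)))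
    as [d Hd].
  exists d. split; [apply cond_pos|]. intros [x y] Hz.
  pose proof (Rmax_Cmod (x, y)) as Hm. simpl in Hm.
  assert (Hx : Rabs x <= 1) by (pose proof (Rmax_l (Rabs x) (Rabs y)); lra).
  assert (Hy : Rabs y <= 1) by (pose proof (Rmax_r (Rabs x) (Rabs y)); lra).
  apply Rabs_le_between in Hx. apply Rabs_le_between in Hy.
  (* [compactness_value_2d] yields its centre under a double negation. *)
  destruct (NNPP _ (Hd x y Hx Hy)) as [u [v [_ [_ [Hu [Hv Huv]]]]]].
  destruct (Hdelta u v) as [delta [H1 H2]]. simpl in *.
  set (w := ((x, y) - (u, v))%C).
  assert (Hw : Cmod w < 2 * delta) by exact (Cmod_lt_box _ _ _ Hu Hv).
  destruct (Rlt_le_dec (Cmod (u, v)) 1) as [H|H].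
  - destruct (H1 H) as [b Hb].
    destruct (recenter _ _ _ Hb) as [G [_ HG]].
    exists (fun n => G n w).
    pose proof (cond_pos delta).
    apply (disk_series_ext _ _ (fun h => f ((u, v) + (w + h))%C)).
    + intros h _. f_equal. unfold w. ring.
    + eapply disk_series_le; [|apply HG; lra]. lra.
  - exfalso. specialize (H2 H).
    pose proof (Cmod_triangle (x, y) (- w)) as Ht. rewrite Cmod_opp in Ht.
    assert (E : (u, v) = ((x, y) + - w)%C)
      by (unfold w, Cminus, Cplus, Copp; simpl; f_equal; ring).
    rewrite <- E in Ht. lra.
Qed.

Lemma taylor_series_exists (f : C -> C) :
  analytic_on_disk f -> (forall z, Cmod z < 1 -> Cmod (f z) <= 1) ->
  exists a, disk_series 1 a f.
Proof.
  intros Hf Hb.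
  destruct (Hf (RtoC 0)) as [r0 [a [Hr0 Ha]]].
  { unfold unit_disk. rewrite Cmod_0; lra. }
  apply power_series_at_disk_series in Ha.
  assert (Ha' : disk_series r0 a f)
    by (apply (disk_series_ext _ _ (fun h => f (0 + h)%C)); [|exact Ha];
        intros z _; now rewrite Cplus_0_l).
  set (E := fun x => x <= 1 /\ disk_series x a f).
  assert (HE0 : E (Rmin r0 1))
    by (split; [apply Rmin_r|eapply disk_series_le; [apply Rmin_l|exact Ha']]).
  destruct (completeness E) as [R0 [Hub Hlub]].
  { exists 1. intros x [Hx _]. exact Hx. }
  { now exists (Rmin r0 1). }
  assert (HR1 : R0 <= 1) by (apply Hlub; intros x [Hx _]; exact Hx).
  assert (HR0 : 0 < R0)
    by (apply Rlt_le_trans with (Rmin r0 1); [apply Rmin_glb_lt; lra|now apply Hub]).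
  assert (HaR : disk_series R0 a f).
  { intros z Hz. apply NNPP. intros Hn.
    assert (R0 <= Cmod z); [|lra]. apply Hlub. intros x [_ Hx].
    destruct (Rle_lt_dec x (Cmod z)) as [H|H]; [exact H|].
    exfalso. now apply Hn, Hx. }
  exists a. destruct (Req_dec R0 1) as [<-|Hne]; [exact HaR|].
  exfalso.
  destruct (uniform_radius f R0 Hf) as [d0 [Hd0 Hloc]]; [lra|].
  (* The bound by 1 - [R0] keeps R0 + d/2 at most 1, and the bound by [R0] keeps the circle of
     radius R0 - d/2 nondegenerate. Extension from that circle reaches R0 + d/2, beyond the
     supremum. *)
  set (d := Rmin d0 (Rmin (1 - R0) R0)).
  assert (Hd1 : 0 < d) by (unfold d; repeat apply Rmin_glb_lt; lra).
  assert (Hd2 : d <= d0) by apply Rmin_l.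
  assert (Hd3 : d <= Rmin (1 - R0) R0) by apply Rmin_r.
  pose proof (Rmin_l (1 - R0) R0). pose proof (Rmin_r (1 - R0) R0).
  assert (Hext : disk_series ((R0 - d / 2) + d) a f).
  { apply (series_extension f a R0 (R0 - d / 2) d); auto; try lra.
    intros z0 Hz0. destruct (Hloc z0) as [b Hb']; [lra|].
    exists b. eapply disk_series_le; [exact Hd2|exact Hb']. }
  assert (R0 - d / 2 + d <= R0); [|lra].
  apply Hub. split; [lra|exact Hext].
Qed.

(** * Subordination *)

(** [F] has no values to use on the unit circle, so the bound is taken on circles of radius tending
    to 1; the limit is harmless in finite sums. *)
Lemma coefficient_domination_disk (a h : nat -> C) (F : C -> C) (K L : nat) :
  disk_series 1 a F ->
  (forall z, Cmod z < 1 -> Cmod (F z) <= Cmod (csum (fun k => h k * z ^ k)%C L)) ->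
  rsum (fun k => Cmod (a k) ^ 2) K <= rsum (fun k => Cmod (h k) ^ 2) L.
Proof.
  intros Ha Hdom.
  set (r := fun n => 1 - / (INR n + 1)).
  assert (Hr : forall n, 0 <= r n < 1).
  { intros n. pose proof (pos_INR n). unfold r.
    assert (0 < / (INR n + 1) <= 1); [|lra].
    split; [apply Rinv_0_lt_compat; lra|].
    rewrite <- Rinv_1. apply Rinv_le_contravar; lra. }
  assert (Hr1 : is_lim_seq r 1).
  { replace 1 with (1 - 0) by ring.
    apply is_lim_seq_minus'; [apply is_lim_seq_const|].
    apply (is_lim_seq_inv (fun n => INR n + 1) p_infty); [|discriminate].
    eapply is_lim_seq_plus; [apply is_lim_seq_INR|apply is_lim_seq_const|].
    reflexivity. }
  assert (Hlim : forall (c : nat -> C) N,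
    is_lim_seq (fun n => rsum (fun k => Cmod (c k) ^ 2 * (r n ^ k) ^ 2) N)
      (rsum (fun k => Cmod (c k) ^ 2) N)).
  { intros c N. apply (rsum_lim (fun k n => Cmod (c k) ^ 2 * (r n ^ k) ^ 2)).
    intros k.
    assert (Hcont : continuity_pt (fun x => Cmod (c k) ^ 2 * (x ^ k) ^ 2) 1)
      by (apply derivable_continuous_pt; reg).
    pose proof (is_lim_seq_continuous _ r 1 Hcont Hr1) as H.
    cbv beta in H. rewrite !pow1, Rmult_1_r in H. exact H. }
  apply (is_lim_seq_le
    (fun n => rsum (fun k => Cmod (a k) ^ 2 * (r n ^ k) ^ 2) K)
    (fun n => rsum (fun k => Cmod (h k) ^ 2 * (r n ^ k) ^ 2) L)
    (rsum (fun k => Cmod (a k) ^ 2) K) (rsum (fun k => Cmod (h k) ^ 2) L)); auto.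
  intros n. apply (coefficient_domination 1 (r n) a h F); auto.
  intros z Hz. apply Hdom. rewrite Hz. apply Hr.
Qed.

Lemma csum_zero_tail (a : nat -> C) (n N : nat) :
  (forall k, (n < k)%nat -> a k = RtoC 0) -> (n <= N)%nat -> csum a N = csum a n.
Proof.
  intros H Hn. induction Hn as [|m Hm IH]; [reflexivity|].
  rewrite csum_S, IH, H by lia. ring.
Qed.

Lemma cseries_finite (a : nat -> C) (n : nat) :
  (forall k, (n < k)%nat -> a k = RtoC 0) -> cseries a (csum a n).
Proof.
  intros H. apply cseries_Cmod.
  apply is_lim_seq_ext_loc with (fun _ => 0); [|apply is_lim_seq_const].
  exists n. intros N HN. rewrite (csum_zero_tail a n N H HN).
  replace (csum a n - csum a n)%C with (RtoC 0) by ring. now rewrite Cmod_0.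
Qed.

Lemma disk_series_0 (rho : R) (a : nat -> C) (F : C -> C) :
  0 < rho -> disk_series rho a F -> F (RtoC 0) = a 0%nat.
Proof.
  intros Hr Ha.
  apply (cseries_unique (fun k => a k * 0 ^ k)%C).
  - apply Ha. now rewrite Cmod_0.
  - replace (a 0%nat) with (csum (fun k => a k * 0 ^ k)%C 0)
      by (rewrite csum_0; simpl; ring).
    apply cseries_finite. intros [|k] Hk; [lia|]. rewrite Cpow_S. ring.
Qed.

Definition monomial (n : nat) (c : C) (k : nat) : C :=
  if (k =? n)%nat then c else RtoC 0.

Lemma csum_single (a : nat -> C) (n : nat) :
  (forall k, (k < n)%nat -> a k = RtoC 0) -> csum a n = a n.
Proof.
  intros H. destruct n as [|n]; [apply csum_0|].
  rewrite csum_S, csum_zero; [ring|]. intros k Hk. apply H. lia.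
Qed.

Lemma disk_series_monomial (rho : R) (n : nat) (c : C) :
  disk_series rho (monomial n c) (fun z => c * z ^ n)%C.
Proof.
  intros z _.
  replace (c * z ^ n)%C with (csum (fun k => monomial n c k * z ^ k)%C n).
  - apply cseries_finite. intros k Hk. unfold monomial.
    destruct (Nat.eqb_spec k n); [lia|ring].
  - rewrite csum_single.
    + unfold monomial. now rewrite Nat.eqb_refl.
    + intros k Hk. unfold monomial. destruct (Nat.eqb_spec k n); [lia|ring].
Qed.

Fixpoint conv_pow (c : nat -> C) (n : nat) : nat -> C :=
  match n with
  | 0%nat => monomial 0 (RtoC 1)
  | S n' => conv c (conv_pow c n')
  end.

Lemma disk_series_pow (rho : R) (c : nat -> C) (f : C -> C) (n : nat) :
  disk_series rho c f -> disk_series rho (conv_pow c n) (fun z => f z ^ n)%C.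
Proof.
  intros Hc. induction n as [|n IH].
  - apply (disk_series_ext _ _ (fun z => 1 * z ^ 0)%C);
      [intros; simpl; ring|apply disk_series_monomial].
  - exact (disk_series_mult rho c (conv_pow c n) f (fun z => f z ^ n)%C Hc IH).
Qed.

Lemma conv_pow_low (c : nat -> C) (n k : nat) :
  c 0%nat = RtoC 0 -> (k < n)%nat -> conv_pow c n k = RtoC 0.
Proof.
  intros Hc. revert k. induction n as [|n IH]; intros k Hk; [lia|].
  simpl. unfold conv. apply csum_zero. intros [|i] Hi.
  - rewrite Hc. ring.
  - rewrite IH by lia. ring.
Qed.

(** The powers of phi are bounded by 1, so the constant polynomial 1 dominates them. *)
Lemma conv_pow_bound (c : nat -> C) (phi : C -> C) (n k : nat) :
  disk_series 1 c phi -> (forall z, Cmod z < 1 -> Cmod (phi z) <= 1) ->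
  Cmod (conv_pow c n k) <= 1.
Proof.
  intros Hc Hphi.
  pose proof (coefficient_domination_disk (conv_pow c n) (fun _ => RtoC 1)
    (fun z => phi z ^ n)%C k 0 (disk_series_pow 1 c phi n Hc)) as H.
  rewrite rsum_0, Cmod_1, pow1 in H.
  assert (H2 : Cmod (conv_pow c n k) ^ 2 <= 1).
  { eapply Rle_trans; [|apply H].
    - apply (rsum_term_le (fun k => Cmod (conv_pow c n k) ^ 2)); [|lia].
      intros i. apply pow2_ge_0.
    - intros z Hz. rewrite csum_0. simpl. rewrite Cmult_1_r, Cmod_1, Cmod_pow.
      rewrite <- (pow1 n). apply pow_incr. split; [apply Cmod_ge_0|now apply Hphi]. }
  apply Rsqr_incr_0_var; [|lra]. unfold Rsqr. simpl in H2. lra.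
Qed.

(** The sum may stop at [k] because phi^n has no coefficient below order n when [c 0] is zero. *)
Definition comp_coeff (c f : nat -> C) (k : nat) : C :=
  csum (fun n => f n * conv_pow c n k)%C k.

(* The coefficients of phi^n are bounded by 1 and vanish below n, so the double
   series of f(phi(z)) is dominated by the sum of |f_n| |z|^n / (1 - |z|). *)
Lemma disk_series_comp (c f : nat -> C) (phi F : C -> C) :
  disk_series 1 c phi -> c 0%nat = RtoC 0 ->
  (forall z, Cmod z < 1 -> Cmod (phi z) < 1) ->
  disk_series 1 f F -> disk_series 1 (comp_coeff c f) (fun z => F (phi z)).
Proof.
  intros Hc Hc0 Hphi Hf z Hz. pose proof (Cmod_ge_0 z) as Hz0.
  set (x := Cmod z) in *.
  set (u := fun n k => (f n * (conv_pow c n k * z ^ k))%C).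
  assert (Hfx : ex_series (fun n => Cmod (f n) * x ^ n))
    by (apply (disk_series_abs 1 f F); [exact Hf|lra]).
  assert (Hgeom : 0 <= / (1 - x)) by (left; apply Rinv_0_lt_compat; lra).
  destruct (triangle_sum u (/ (1 - x) * Series (fun n => Cmod (f n) * x ^ n)))
    as [r [l [H1 [H2 H3]]]].
  - intros n k Hnk. unfold u. rewrite conv_pow_low by auto. ring.
  - intros N.
    apply Rle_trans with (rsum (fun n => / (1 - x) * (Cmod (f n) * x ^ n)) N).
    + apply rsum_le_loc. intros n _.
      assert (Hn0 : 0 <= Cmod (f n) * x ^ n)
        by (apply Rmult_le_pos; [apply Cmod_ge_0|now apply pow_le]).
      apply Rle_trans with (rsum (delay 0 n (fun k => (Cmod (f n) * x ^ n) * x ^ k)) N).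
      * apply rsum_le_loc. intros k _. unfold u, delay.
        rewrite !Cmod_mult, Cmod_pow. fold x.
        destruct (Nat.ltb_spec k n) as [Hk|Hk].
        -- rewrite conv_pow_low, Cmod_0 by auto. lra.
        -- rewrite Rmult_assoc, <- pow_add.
           replace (n + (k - n))%nat with k by lia.
           apply Rmult_le_compat_l; [apply Cmod_ge_0|].
           rewrite <- (Rmult_1_l (x ^ k)) at 2.
           apply Rmult_le_compat_r; [now apply pow_le|].
           apply (conv_pow_bound c phi); [exact Hc|].
           intros w Hw. left. now apply Hphi.
      * eapply Rle_trans; [apply rsum_delay_le|].
        { intros k. apply Rmult_le_pos; [exact Hn0|now apply pow_le]. }
        rewrite rsum_scal, Rmult_comm. apply Rmult_le_compat_r; [exact Hn0|].
        apply rsum_geom_le. lra.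
    + rewrite rsum_scal. apply Rmult_le_compat_l; [exact Hgeom|].
      apply rsum_le_Series; [|exact Hfx].
      intros n. apply Rmult_le_pos; [apply Cmod_ge_0|now apply pow_le].
  - replace (F (phi z)) with l.
    + eapply cseries_ext; [|exact H3]. intros k. simpl. unfold comp_coeff.
      rewrite Cmult_comm, <- csum_scal. apply csum_ext. intros n _. unfold u. ring.
    + apply (cseries_unique r); [exact H2|].
      apply (cseries_ext (fun n => f n * phi z ^ n)%C).
      * intros n. apply (cseries_unique (u n)); [|apply H1].
        apply cseries_scal. exact (disk_series_pow 1 c phi n Hc z Hz).
      * apply Hf, Hphi, Hz.
Qed.

(** Coefficient form of f o phi = f_0 + phi (g o phi). Every sum is finite, so the identity is
    formal and holds for an arbitrary sequence [f]. *)
Lemma comp_coeff_S (c f : nat -> C) (k : nat) :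
  c 0%nat = RtoC 0 ->
  comp_coeff c f (S k) = conv c (comp_coeff c (fun n => f (S n))) (S k).
Proof.
  intros Hc. unfold comp_coeff at 1.
  rewrite csum_shift. change (conv_pow c 0 (S k)) with (RtoC 0).
  rewrite Cmult_0_r, Cplus_0_l.
  transitivity (csum (fun n => csum (fun i =>
     c i * (f (S n) * conv_pow c n (S k - i)))%C (S k)) k).
  { apply csum_ext. intros n _. change (conv_pow c (S n)) with (conv c (conv_pow c n)). unfold conv.
    rewrite <- csum_scal. apply csum_ext. intros i _. ring. }
  transitivity (csum (fun i => csum (fun n =>
     c i * (f (S n) * conv_pow c n (S k - i)))%C k) (S k)).
  { exact (sum_n_switch (fun n i =>
     c i * (f (S n) * conv_pow c n (S k - i)))%C k (S k)). }
  unfold conv. apply csum_ext. intros i Hi. rewrite csum_scal.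
  destruct i as [|i]; [rewrite Hc; ring|]. f_equal.
  unfold comp_coeff. apply csum_zero_tail; [|lia].
  intros n Hn. rewrite conv_pow_low by (auto; lia). ring.
Qed.

(* Rogosinski's inequality. *)
Lemma rogosinski (c f : nat -> C) (phi : C -> C) (K : nat) :
  disk_series 1 c phi -> c 0%nat = RtoC 0 ->
  (forall z, Cmod z < 1 -> Cmod (phi z) <= 1) ->
  rsum (fun k => Cmod (comp_coeff c f k) ^ 2) K <= rsum (fun k => Cmod (f k) ^ 2) K.
Proof.
  intros Hc Hc0 Hphi.
  assert (Hf0 : forall f, comp_coeff c f 0 = f 0%nat).
  { intros g. unfold comp_coeff. rewrite csum_0. simpl. unfold monomial. simpl. ring. }
  revert f. induction K as [|K IH]; intros f.
  - rewrite !rsum_0, Hf0. lra.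
  - rewrite !rsum_shift, Hf0. apply Rplus_le_compat_l.
    eapply Rle_trans; [|apply (IH (fun n => f (S n)))].
    set (w := comp_coeff c (fun n => f (S n))).
    (* [w] need not be the coefficients of a convergent series. Cutting it at degree [K] gives a
       polynomial, and since [c 0] is zero its product with phi keeps the same coefficients up to
       order K + 1. *)
    set (w' := fun k => if (k <=? K)%nat then w k else RtoC 0).
    assert (Hw' : disk_series 1 w' (fun z => csum (fun k => w k * z ^ k)%C K)).
    { intros z _.
      rewrite (csum_ext _ (fun k => w' k * z ^ k)%C).
      - apply cseries_finite. intros k Hk. unfold w'.
        destruct (Nat.leb_spec k K); [lia|ring].
      - intros k Hk. unfold w'. destruct (Nat.leb_spec k K); [ring|lia]. }
    pose proof (coefficient_domination_disk (conv c w') w _ (S K) K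
      (disk_series_mult 1 c w' phi _ Hc Hw')) as H.
    rewrite rsum_shift in H.
    assert (E : rsum (fun k => Cmod (conv c w' (S k)) ^ 2) K
              = rsum (fun k => Cmod (comp_coeff c f (S k)) ^ 2) K).
    { apply rsum_ext. intros k Hk. rewrite comp_coeff_S by exact Hc0.
      do 2 f_equal. unfold conv. apply csum_ext. intros [|i] Hi; [rewrite Hc0; ring|].
      unfold w'. destruct (Nat.leb_spec (S k - S i) K); [reflexivity|lia]. }
    rewrite E in H. pose proof (pow2_ge_0 (Cmod (conv c w' 0))).
    eapply Rle_trans; [|apply H]; [lra|].
    intros z Hz. rewrite Cmod_mult.
    rewrite <- (Rmult_1_l (Cmod (csum _ K))) at 2.
    apply Rmult_le_compat_r; [apply Cmod_ge_0|now apply Hphi].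
Qed.

(** * Abel summation and weighted norms *)

Lemma abel_le (x y mu : nat -> R) (K : nat) :
  (forall N, rsum x N <= rsum y N) ->
  (forall k, 0 <= mu (S k) <= mu k) ->
  rsum (fun k => x k * mu k) K <= rsum (fun k => y k * mu k) K.
Proof.
  intros Hxy Hmu.
  (* The boundary term carries the induction: the gap between partial sums is nonnegative and its
     weight only decreases. *)
  assert (H : (rsum y K - rsum x K) * mu K
     <= rsum (fun k => y k * mu k) K - rsum (fun k => x k * mu k) K).
  { induction K as [|K IH].
    - rewrite !rsum_0. lra.
    - rewrite !rsum_S. specialize (Hmu K). pose proof (Hxy K). nra. }
  assert (0 <= mu K) by (specialize (Hmu K); lra).
  pose proof (Hxy K). nra.
Qed.

Fixpoint running_min (beta : nat -> R) (k : nat) : R :=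
  match k with
  | 0%nat => beta 0%nat
  | S k' => Rmin (running_min beta k') (beta (S k'))
  end.

(** Attainment at an index at most [k] is what turns essential decrease into a bound of [beta k] by
    a multiple of the running minimum, and it makes the minimum positive. *)
Lemma running_min_attained (beta : nat -> R) (k : nat) :
  exists n, (n <= k)%nat /\ running_min beta k = beta n.
Proof.
  induction k as [|k [n [Hn E]]]; [now exists 0%nat|]. simpl.
  unfold Rmin. destruct (Rle_dec _ _); [exists n; split; [lia|exact E]|].
  now exists (S k).
Qed.

Lemma running_min_le (beta : nat -> R) (k : nat) : running_min beta k <= beta k.
Proof. destruct k; [apply Rle_refl|apply Rmin_r]. Qed.

(** The constant is paid only once: replacing [beta] by [mu] costs [K] for the image, while
    returning from [mu] to [beta] for [f] is free. *)
Lemma comp_weighted_bound (beta : nat -> R) (K : R) (c f : nat -> C) (phi : C -> C) :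
  (forall n, 0 < beta n) ->
  (forall m n, (n <= m)%nat -> beta m <= K * beta n) -> 0 <= K ->
  disk_series 1 c phi -> c 0%nat = RtoC 0 ->
  (forall z, Cmod z < 1 -> Cmod (phi z) <= 1) ->
  ex_series (fun n => Cmod (f n) ^ 2 * beta n) ->
  ex_series (fun n => Cmod (comp_coeff c f n) ^ 2 * beta n) /\
  Series (fun n => Cmod (comp_coeff c f n) ^ 2 * beta n)
    <= K * Series (fun n => Cmod (f n) ^ 2 * beta n).
Proof.
  intros Hpos HK HK0 Hc Hc0 Hphi Hf.
  set (mu := running_min beta).
  assert (Hmu0 : forall k, 0 < mu k).
  { intros k. destruct (running_min_attained beta k) as [n [_ E]].
    unfold mu. rewrite E. apply Hpos. }
  apply series_nonneg_bounded.
  - intros k. apply Rmult_le_pos; [apply pow2_ge_0|left; apply Hpos].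
  - intros N.
    apply Rle_trans with (K * rsum (fun k => Cmod (comp_coeff c f k) ^ 2 * mu k) N).
    { rewrite <- rsum_scal. apply rsum_le_loc. intros k _.
      destruct (running_min_attained beta k) as [n [Hn E]].
      assert (Hb : beta k <= K * mu k) by (unfold mu; rewrite E; now apply HK).
      pose proof (pow2_ge_0 (Cmod (comp_coeff c f k))). nra. }
    apply Rmult_le_compat_l; [exact HK0|].
    apply Rle_trans with (rsum (fun k => Cmod (f k) ^ 2 * mu k) N).
    { apply (abel_le (fun k => Cmod (comp_coeff c f k) ^ 2) (fun k => Cmod (f k) ^ 2)).
      - intros M. now apply (rogosinski c f phi).
      - intros k. split; [left; apply Hmu0|apply Rmin_l]. }
    apply Rle_trans with (rsum (fun k => Cmod (f k) ^ 2 * beta k) N).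
    { apply rsum_le_loc. intros k _.
      apply Rmult_le_compat_l; [apply pow2_ge_0|apply running_min_le]. }
    apply rsum_le_Series; [|exact Hf].
    intros k. apply Rmult_le_pos; [apply pow2_ge_0|left; apply Hpos].
Qed.

(** * Composition operators *)

Lemma disk_series_analytic (a : nat -> C) (f : C -> C) :
  disk_series 1 a f -> analytic_on_disk f.
Proof.
  intros Ha z0 Hz0. unfold unit_disk in Hz0.
  destruct (recenter 1 a f Ha) as [G [_ HG]].
  exists (1 - Cmod z0), (fun n => G n z0). split; [lra|].
  apply power_series_at_disk_series, HG, Hz0.
Qed.

(** [H2_norm] hides its coefficients under an existential; uniqueness of Taylor coefficients allows
    the norm to be computed with any known expansion. *)
Lemma H2_norm_coeff (beta : nat -> R) (f : C -> C) (a : nat -> C) (x : R) :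
  disk_series 1 a f -> H2_norm beta f x ->
  ex_series (fun n => Cmod (a n) ^ 2 * beta n) /\
  x = sqrt (Series (fun n => Cmod (a n) ^ 2 * beta n)).
Proof.
  intros Ha [b [Hb [Hex Hx]]]. apply taylor_disk_series in Hb.
  assert (E : forall n, Cmod (b n) ^ 2 * beta n = Cmod (a n) ^ 2 * beta n)
    by (intros n; now rewrite (disk_series_unique 1 a b f n Rlt_0_1 Ha Hb)).
  split; [eapply ex_series_ext; [exact E|exact Hex]|].
  rewrite Hx. f_equal. apply Series_ext, E.
Qed.

Lemma comp_op_estimate (beta : nat -> R) (K : R) (phi f : C -> C) :
  (forall n, 0 < beta n) ->
  (forall m n, (n <= m)%nat -> beta m <= K * beta n) -> 0 <= K ->
  symbol phi -> phi (RtoC 0) = RtoC 0 ->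
  H2 beta f ->
  H2 beta (comp_op phi f) /\
  forall x y, H2_norm beta f x -> H2_norm beta (comp_op phi f) y -> y <= sqrt K * x.
Proof.
  intros Hpos HK HK0 [Han [Hdisk _]] Hphi0 [a [Ha Hex]].
  apply taylor_disk_series in Ha.
  assert (Hle : forall z, Cmod z < 1 -> Cmod (phi z) <= 1)
    by (intros z Hz; left; now apply Hdisk).
  destruct (taylor_series_exists phi Han Hle) as [c Hc].
  assert (Hc0 : c 0%nat = RtoC 0)
    by (rewrite <- Hphi0; symmetry; apply (disk_series_0 1); [lra|exact Hc]).
  pose proof (disk_series_comp c a phi f Hc Hc0 Hdisk Ha) as Hg.
  destruct (comp_weighted_bound beta K c a phi Hpos HK HK0 Hc Hc0 Hle Hex)
    as [Hgex Hgle].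
  split.
  - exists (comp_coeff c a). split; [apply taylor_disk_series; exact Hg|exact Hgex].
  - intros x y Hx Hy.
    destruct (H2_norm_coeff beta f a x Ha Hx) as [_ ->].
    destruct (H2_norm_coeff beta (comp_op phi f) _ y Hg Hy) as [_ ->].
    rewrite <- sqrt_mult_alt by exact HK0. now apply sqrt_le_1_alt.
Qed.

(** * Lacunary test symbols *)

(* [lacunary_pow s t j i] lists the coefficients of (s z + t z^(j+1))^i. *)
Fixpoint lacunary_pow (s t : R) (j i : nat) : nat -> R :=
  match i with
  | 0%nat => fun k => if (k =? 0)%nat then 1 else 0
  | S i' => fun k => s * delay 0 1 (lacunary_pow s t j i') k
                   + t * delay 0 (S j) (lacunary_pow s t j i') k
  end.

Lemma disk_series_delay (rho : R) (i : nat) (a : nat -> C) (f : C -> C) :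
  disk_series rho a f -> disk_series rho (delay (RtoC 0) i a) (fun z => z ^ i * f z)%C.
Proof.
  intros Ha z Hz.
  apply (cseries_ext (delay (RtoC 0) i (fun k => z ^ i * (a k * z ^ k))%C)).
  - intros k. unfold delay. destruct (Nat.ltb_spec k i); [ring|].
    replace (z ^ k)%C with (z ^ (i + (k - i)))%C by (f_equal; lia).
    rewrite Cpow_add_r. ring.
  - apply cseries_delay, cseries_scal, Ha, Hz.
Qed.

Lemma disk_series_lacunary (s t : R) (j i : nat) :
  disk_series 1 (fun k => RtoC (lacunary_pow s t j i k))
    (fun z => (s * z + t * z ^ S j) ^ i)%C.
Proof.
  induction i as [|i IH].
  - intros z Hz. apply (cseries_ext (fun k => monomial 0 1 k * z ^ k)%C).
    + intros k. unfold monomial. simpl. now destruct (k =? 0)%nat.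
    + replace ((s * z + t * z ^ S j) ^ 0)%C with (1 * z ^ 0)%C by (simpl; ring).
      now apply (disk_series_monomial 1).
  - intros z Hz.
    pose proof (disk_series_delay 1 1 _ _ IH z Hz) as H1.
    pose proof (disk_series_delay 1 (S j) _ _ IH z Hz) as H2.
    replace ((s * z + t * z ^ S j) ^ S i)%C
      with (s * (z ^ 1 * (s * z + t * z ^ S j) ^ i)
            + t * (z ^ S j * (s * z + t * z ^ S j) ^ i))%C
      by (rewrite (Cpow_S _ i), Cpow_1_r; ring).
    eapply cseries_ext;
      [|apply cseries_plus; apply cseries_scal; [exact H1|exact H2]].
    intros k. cbn beta. simpl lacunary_pow.
    assert (Hd : forall n (b : nat -> R),
      delay (RtoC 0) n (fun k => RtoC (b k)) k = RtoC (delay 0 n b k))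
      by (intros n b; unfold delay; now destruct (k <? n)%nat).
    rewrite !Hd, RtoC_plus, !RtoC_mult. ring.
Qed.

Lemma lacunary_pow_nonneg (s t : R) (j i k : nat) :
  0 <= s -> 0 <= t -> 0 <= lacunary_pow s t j i k.
Proof.
  intros Hs Ht. revert k. induction i as [|i IH]; intros k; simpl.
  - destruct (k =? 0)%nat; lra.
  - apply Rplus_le_le_0_compat; apply Rmult_le_pos; auto; unfold delay;
      destruct (_ <? _)%nat; auto; lra.
Qed.

Lemma lacunary_pow_diag (s t : R) (j i : nat) :
  0 <= s -> 0 <= t -> s ^ i <= lacunary_pow s t j i i.
Proof.
  intros Hs Ht. induction i as [|i IH]; [simpl; lra|].
  cbn [lacunary_pow]. rewrite !delay_S.
  replace (delay 0 0 (lacunary_pow s t j i) i) with (lacunary_pow s t j i i)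
    by (unfold delay; simpl; now rewrite Nat.sub_0_r).
  assert (0 <= delay 0 j (lacunary_pow s t j i) i).
  { unfold delay. destruct (_ <? _)%nat; [lra|now apply lacunary_pow_nonneg]. }
  simpl. nra.
Qed.

(** The term t z^(j+1) can be picked once among [S i] factors, and all other contributions are
    nonnegative. An inequality also covers [j] = 0, where both terms of the symbol have degree
    one. *)
Lemma lacunary_pow_second (s t : R) (j i : nat) :
  0 <= s -> 0 <= t ->
  INR (S i) * (s ^ i * t) <= lacunary_pow s t j (S i) (S i + j).
Proof.
  intros Hs Ht.
  assert (Hstep : forall i, lacunary_pow s t j (S i) (S i + j)
     = s * lacunary_pow s t j i (i + j) + t * lacunary_pow s t j i i).
  { intros n. change (S n + j)%nat with (S (n + j)).
    cbn [lacunary_pow]. rewrite !delay_S. unfold delay. simpl.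
    rewrite Nat.sub_0_r. destruct (Nat.ltb_spec (n + j) j); [lia|].
    now rewrite Nat.add_sub. }
  induction i as [|i IH]; rewrite Hstep.
  - pose proof (lacunary_pow_nonneg s t j 0 (0 + j) Hs Ht).
    pose proof (lacunary_pow_diag s t j 0 Hs Ht) as Hd. simpl in *. nra.
  - pose proof (lacunary_pow_diag s t j (S i) Hs Ht) as Hd.
    rewrite S_INR. apply Rmult_le_compat_l with (r := s) in IH; [|exact Hs].
    apply Rmult_le_compat_l with (r := t) in Hd; [|exact Ht].
    rewrite <- (tech_pow_Rmult s i) in *. lra.
Qed.

Lemma exp_INR_mult (x : R) (n : nat) : exp (INR n * x) = exp x ^ n.
Proof.
  induction n as [|n IH]; [simpl; now rewrite Rmult_0_l, exp_0|].
  now rewrite S_INR, Rmult_plus_distr_r, Rmult_1_l, exp_plus, IH, Rmult_comm.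
Qed.

(** For positive [n] the inverse of the right-hand side is (1 + 1/n)^n, which is at most e, hence at
    most 3. *)
Lemma one_minus_inv_pow_lower (n : nat) : / 3 <= (1 - / INR (S n)) ^ n.
Proof.
  destruct n as [|n]; [simpl; lra|].
  assert (Hn : 0 < INR (S n)) by (apply lt_0_INR; lia).
  rewrite (S_INR (S n)).
  replace (1 - / (INR (S n) + 1)) with (/ (1 + / INR (S n))) by (field; lra).
  rewrite pow_inv.
  assert (Hi : 0 < / INR (S n)) by now apply Rinv_0_lt_compat.
  apply Rinv_le_contravar; [apply pow_lt; lra|].
  apply Rle_trans with (exp (/ INR (S n)) ^ S n).
  - apply pow_incr. split; [lra|]. left. apply exp_ineq1. lra.
  - rewrite <- exp_INR_mult. replace (INR (S n) * / INR (S n)) with 1 by (field; lra).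
    apply exp_le_3.
Qed.

Lemma lacunary_symbol (s t : R) (j : nat) :
  0 <= s -> 0 < t -> s + t = 1 -> symbol (fun z => s * z + t * z ^ S j)%C.
Proof.
  intros Hs Ht Hst. split; [|split].
  - apply (disk_series_analytic (fun k => RtoC (lacunary_pow s t j 1 k))).
    apply (disk_series_ext _ _ (fun z => (s * z + t * z ^ S j) ^ 1)%C);
      [intros; apply Cpow_1_r|apply disk_series_lacunary].
  - intros z Hz. unfold unit_disk in *. pose proof (Cmod_ge_0 z).
    eapply Rle_lt_trans; [apply Cmod_triangle|].
    rewrite !Cmod_mult, Cmod_pow, !Cmod_R, !Rabs_pos_eq by lra.
    assert (Hp : Cmod z ^ S j <= Cmod z).
    { simpl. rewrite <- (Rmult_1_r (Cmod z)) at 3.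
      apply Rmult_le_compat_l; [lra|]. rewrite <- (pow1 j). apply pow_incr. lra. }
    nra.
  (* Since [s] may be 0, the two values are separated by the term in [t]. *)
  - exists (RtoC (/ 2)), (RtoC 0). unfold unit_disk.
    rewrite Cmod_0, Cmod_R, Rabs_pos_eq by lra. repeat split; try lra.
    cbv beta. rewrite !Cpow_S, !Cmult_0_l, !Cmult_0_r, Cplus_0_l.
    rewrite <- RtoC_pow, <- !RtoC_mult, <- RtoC_plus.
    intros E. apply RtoC_inj in E.
    assert (0 < t * (/ 2 * (/ 2) ^ j))
      by (repeat apply Rmult_lt_0_compat; try lra; apply pow_lt; lra).
    lra.
Qed.

(** The test function is the monomial of degree [S n] divided by its norm. One coefficient of its
    image, at least c/3 in modulus, already forces c^2 [beta m] / 9 to be at most M^2, where c^2 is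
    the inverse of [beta (S n)]. *)
Lemma weight_ratio_bound (beta : nat -> R) (M : R) (n j : nat) :
  (forall n, 0 < beta n) ->
  (forall phi, symbol phi -> phi (RtoC 0) = RtoC 0 ->
     comp_op_bounded beta phi /\
     forall f x y, H2_norm beta f x -> x <= 1 -> H2_norm beta (comp_op phi f) y ->
       y <= M) ->
  beta (S n + j)%nat <= 9 * M ^ 2 * beta (S n).
Proof.
  intros Hpos HM.
  assert (Hn : 0 < INR (S n)) by (apply lt_0_INR; lia).
  (* With this [t], the lower bound (n + 1) s^n t of [lacunary_pow_second] reduces to s^n. For [n] =
     0 it gives [s] = 0 and the bound is 1. *)
  set (t := / INR (S n)). set (s := 1 - t).
  assert (Ht : 0 < t) by now apply Rinv_0_lt_compat.
  assert (Ht1 : t <= 1).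
  { unfold t. rewrite <- Rinv_1. apply Rinv_le_contravar; [lra|].
    rewrite S_INR. pose proof (pos_INR n). lra. }
  set (phi := (fun z => s * z + t * z ^ S j)%C).
  assert (Hphi : symbol phi) by (apply lacunary_symbol; unfold s; lra).
  assert (Hphi0 : phi (RtoC 0) = RtoC 0) by (unfold phi; rewrite Cpow_S; ring).
  destruct (HM phi Hphi Hphi0) as [[Hmap _] Hnorm].
  set (b := beta (S n)). assert (Hb : 0 < b) by apply Hpos.
  set (c := / sqrt b).
  assert (Hsb : 0 < sqrt b) by now apply sqrt_lt_R0.
  assert (Hc0 : 0 < c) by now apply Rinv_0_lt_compat.
  assert (Hc : c ^ 2 * b = 1).
  { unfold c. rewrite <- (sqrt_sqrt b) at 2 by lra. field. lra. }
  set (f := (fun z => c * z ^ S n)%C).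
  assert (Hf : disk_series 1 (monomial (S n) c) f) by apply disk_series_monomial.
  assert (Hser : is_series (fun k => Cmod (monomial (S n) c k) ^ 2 * beta k) 1).
  { change (is_lim_seq (rsum (fun k => Cmod (monomial (S n) c k) ^ 2 * beta k)) 1).
    apply (is_lim_seq_ext_loc (fun _ => 1)); [|apply is_lim_seq_const].
    exists (S n). intros N HN. symmetry.
    assert (Hz : forall k, k <> S n -> Cmod (monomial (S n) c k) ^ 2 * beta k = 0).
    { intros k Hk. unfold monomial. apply Nat.eqb_neq in Hk. rewrite Hk, Cmod_0. ring. }
    rewrite (rsum_zero_tail _ (S n) N); [|intros; apply Hz; lia|exact HN].
    rewrite rsum_S, (rsum_ext _ (fun _ => 0)) by (intros; apply Hz; lia).
    rewrite rsum_const, Rmult_0_r, Rplus_0_l. unfold monomial.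
    rewrite Nat.eqb_refl, Cmod_R, Rabs_pos_eq by lra. exact Hc. }
  assert (HfH : H2_norm beta f 1).
  { exists (monomial (S n) c). split; [now apply taylor_disk_series|].
    split; [now exists 1|]. now rewrite (is_series_unique _ _ Hser), sqrt_1. }
  destruct (Hmap f) as [g [Hg Hgex]].
  { exists (monomial (S n) c). split; [now apply taylor_disk_series|now exists 1]. }
  apply taylor_disk_series in Hg.
  set (q := fun k => (c * lacunary_pow s t j (S n) k)%C).
  assert (Hq : disk_series 1 q (comp_op phi f)).
  { intros z Hz. unfold comp_op, f.
    apply (cseries_ext (fun k => c * (lacunary_pow s t j (S n) k * z ^ k))%C).
    - intros k. unfold q. ring.
    - apply cseries_scal. exact (disk_series_lacunary s t j (S n) z Hz). }
  set (y2 := Series (fun k => Cmod (g k) ^ 2 * beta k)) in *.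
  assert (Hy : sqrt y2 <= M).
  { apply (Hnorm f 1); [exact HfH|lra|].
    exists g. split; [now apply taylor_disk_series|now split]. }
  assert (Hterm : forall k, 0 <= Cmod (g k) ^ 2 * beta k)
    by (intros k; apply Rmult_le_pos; [apply pow2_ge_0|left; apply Hpos]).
  set (m := (S n + j)%nat).
  assert (Hlow : Cmod (g m) ^ 2 * beta m <= y2).
  { eapply Rle_trans; [|apply (rsum_le_Series _ m Hterm Hgex)].
    now apply (rsum_term_le (fun k => Cmod (g k) ^ 2 * beta k)). }
  assert (Hy2 : y2 <= M ^ 2).
  { assert (Hy0 : 0 <= y2) by (eapply Rle_trans; [apply (Hterm m)|exact Hlow]).
    rewrite <- (sqrt_sqrt y2) by exact Hy0. pose proof (sqrt_pos y2). nra. }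
  assert (Hcoef : / 3 <= lacunary_pow s t j (S n) m).
  { eapply Rle_trans; [apply (one_minus_inv_pow_lower n)|].
    eapply Rle_trans; [|apply lacunary_pow_second; unfold s; lra].
    fold t. fold s. apply Req_le. unfold t. field. lra. }
  assert (Hgm : Cmod (g m) = c * lacunary_pow s t j (S n) m).
  { rewrite (disk_series_unique 1 g q _ m Rlt_0_1 Hg Hq). unfold q.
    rewrite Cmod_mult, !Cmod_R, !Rabs_pos_eq by lra. reflexivity. }
  rewrite Hgm in Hlow. pose proof (Hpos m) as Hbm. fold b.
  set (p := lacunary_pow s t j (S n) m) in *.
  assert (Hp2 : / 9 <= p ^ 2) by nra.
  assert (H1 : c ^ 2 * (p ^ 2 * beta m) <= M ^ 2)
    by (replace (c ^ 2 * (p ^ 2 * beta m)) with ((c * p) ^ 2 * beta m) by ring; lra).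
  apply Rmult_le_compat_r with (r := b) in H1; [|lra].
  replace (c ^ 2 * (p ^ 2 * beta m) * b) with (p ^ 2 * beta m) in H1
    by (transitivity (c ^ 2 * b * (p ^ 2 * beta m)); [rewrite Hc; ring|ring]).
  nra.
Qed.

Theorem proposition3p2 (beta : nat -> R) (hbeta : weight beta) :
  ((forall phi : C -> C, symbol phi -> phi (RtoC 0) = RtoC 0 ->
      comp_op_bounded beta phi) /\
   Rbar_lt
     (Rbar_lub (fun N : Rbar => exists phi : C -> C,
        symbol phi /\ phi (RtoC 0) = RtoC 0 /\ N = comp_op_norm beta phi))
     p_infty)
  <-> essentially_decreasing beta.
Proof.
  destruct hbeta as [Hpos _].
  set (E := fun N : Rbar => exists phi : C -> C,
        symbol phi /\ phi (RtoC 0) = RtoC 0 /\ N = comp_op_norm beta phi).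
  assert (HE : Rbar_is_lub E (Rbar_lub E)) by (unfold Rbar_lub; apply proj2_sig).
  destruct HE as [Hub Hleast].
  split.
  - intros [Hbd Hfin].
    set (M := real (Rbar_lub E)).
    assert (HM : forall phi, symbol phi -> phi (RtoC 0) = RtoC 0 ->
      comp_op_bounded beta phi /\
      forall f x y, H2_norm beta f x -> x <= 1 -> H2_norm beta (comp_op phi f) y ->
        y <= M).
    { intros phi Hphi Hphi0. split; [now apply Hbd|].
      intros f x y Hx Hx1 Hy.
      assert (Hle : Rbar_le y (Rbar_lub E)).
      { apply Rbar_le_trans with (comp_op_norm beta phi).
        - apply (proj1 (Lub_Rbar_correct _)). now exists f, x.
        - apply Hub. now exists phi. }
      (* The default value of [real] is not met: [Hfin] excludes [p_infty] and [Hle] excludes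
         [m_infty]. *)
      unfold M. destruct (Rbar_lub E); simpl in *; tauto. }
    assert (Hratio : forall n m, (S n <= m)%nat -> beta m <= 9 * M ^ 2 * beta (S n)).
    { intros n m Hnm. replace m with (S n + (m - S n))%nat by lia.
      now apply weight_ratio_bound. }
    assert (HM2 : 0 <= 9 * M ^ 2) by (pose proof (pow2_ge_0 M); lra).
    pose proof (Hpos 0%nat) as H0. pose proof (Hpos 1%nat) as H1.
    assert (Hq : 0 <= beta 1%nat / beta 0%nat) by (apply Rdiv_le_0_compat; lra).
    (* The summand 1 covers [m] = [n] = 0 and gives 1 <= K, the second covers positive [n], and the
       third covers [n] = 0 by passing through [beta 1]. *)
    set (K := 1 + 9 * M ^ 2 + 9 * M ^ 2 * (beta 1%nat / beta 0%nat)).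
    assert (Hqq : 0 <= 9 * M ^ 2 * (beta 1%nat / beta 0%nat))
      by now apply Rmult_le_pos.
    exists K. split; [unfold K; lra|].
    intros m n Hnm. destruct n as [|n].
    + destruct m as [|m].
      * unfold K. nra.
      * pose proof (Hratio 0%nat (S m) ltac:(lia)) as H.
        replace (9 * M ^ 2 * beta 1%nat)
          with (9 * M ^ 2 * (beta 1%nat / beta 0%nat) * beta 0%nat) in H by (field; lra).
        unfold K. nra.
    + pose proof (Hratio n m Hnm). pose proof (Hpos (S n)). unfold K. nra.
  - intros [K [HK1 HK]].
    assert (HK0 : 0 <= K) by lra.
    split.
    + intros phi Hphi Hphi0. split.
      * intros f Hf. now apply (comp_op_estimate beta K phi f).
      * exists (sqrt K). intros f x y Hx Hy.
        assert (Hf : H2 beta f) by (destruct Hx as [a [Ha [Hex _]]]; now exists a).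
        now apply (comp_op_estimate beta K phi f Hpos HK HK0 Hphi Hphi0 Hf).
    + apply Rbar_le_lt_trans with (sqrt K); [|exact I].
      apply Hleast. intros N [phi [Hphi [Hphi0 ->]]].
      apply (proj2 (Lub_Rbar_correct _)). intros y [f [x [Hx [Hx1 Hy]]]].
      assert (Hf : H2 beta f) by (destruct Hx as [a [Ha [Hex _]]]; now exists a).
      destruct (comp_op_estimate beta K phi f Hpos HK HK0 Hphi Hphi0 Hf) as [_ H].
      specialize (H x y Hx Hy). pose proof (sqrt_pos K). simpl. nra.
Qed.
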